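(* Let $a,b>0$ be fixed and set $I(a,b):=\left\langle \sigma(a,b),\frac25\right\rangle$, where $\langle c,d\rangle=(\min(c,d),\max(c,d))$ and $$\sigma(a,b):=\frac{1}{2\pi}\arccos\left(\frac12\left[-1-\frac{a+b\,x_c}{x_c(b+x_c)}\right]\right)=\frac{1}{2\pi}\arccos\left(\frac12\left[-2+\frac{1}{x_cy_c}\right]\right).$$ Then for any $\theta\in I(a,b)$ there exists at least one oval of the form $\mathcal{C}_h^+$ (with $h>h_c$) such that the map $F_{b,a}$ restricted to this oval is conjugate to a rotation with rotation number $\theta_{b,a}(h)=\theta$.
   Context: Let $\mathcal{Q}^+=\{(x,y)\in\mathbb{R}^2: x>0,\,y>0\}$. For $a,b>0$ let $$F_{b,a}(x,y)=\left(\frac{a+y}{x},\frac{a+bx+y}{xy}\right),\qquad V_{b,a}(x,y)=\frac{(bx+a)(ay+b)(ax+by+ab)}{xy}.$$ $V_{b,a}$ is a first integral of $F_{b,a}$ (i.e. $V_{b,a}\circ F_{b,a}=V_{b,a}$). $F_{b,a}$ has a unique fixed point $(x_c,y_c)$ in $\mathcal{Q}^+$, the unique solution in $\mathcal{Q}^+$ of $x^2=a+y$, $y^2=b+x$; it is the unique global minimum of $V_{b,a}$ in $\mathcal{Q}^+$. Put $h_c=V_{b,a}(x_c,y_c)$ and, for $h>h_c$, $\mathcal{C}_h^+=\{V_{b,a}=h\}\cap\mathcal{Q}^+$, which is a closed curve (an oval) invariant under $F_{b,a}$. The restriction of $F_{b,a}$ to $\mathcal{C}_h^+$ is conjugate to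 a rotation of the unit circle of angle $2\pi\theta_{b,a}(h)$; the rotation number $\theta_{b,a}(h)$ is taken with the determination $\theta_{b,a}(h)\in[0,1/2]$. *)

(* Defs.v *)
From mathcomp Require Import all_boot all_order all_algebra.
From mathcomp Require Import all_classical all_reals all_analysis.
Import Order.TTheory GRing.Theory Num.Theory.
Import numFieldNormedType.Exports.

Set Implicit Arguments.
Unset Strict Implicit.
Unset Printing Implicit Defensive.

Local Open Scope classical_set_scope.
Local Open Scope ring_scope.

Definition quadrant (R : realType) : set (R * R) :=
  [set p | 0 < p.1 /\ 0 < p.2].

(* The parameters come in the order of the subscripts of F_{b,a}, V_{b,a}. *)
Definition Fmap (R : realType) (b a : R) (p : R * R) : R * R :=
  ((a + p.2) / p.1, (a + b * p.1 + p.2) / (p.1 * p.2)).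

Definition Vinv (R : realType) (b a : R) (p : R * R) : R :=
  (b * p.1 + a) * (a * p.2 + b) * (a * p.1 + b * p.2 + a * b) / (p.1 * p.2).

Definition oval (R : realType) (b a h : R) : set (R * R) :=
  [set p | quadrant p /\ Vinv b a p = h].

Definition circle (R : realType) : set (R * R) :=
  [set p | p.1 ^+ 2 + p.2 ^+ 2 = 1].

Definition rotation (R : realType) (t : R) (p : R * R) : R * R :=
  (cos t * p.1 - sin t * p.2, sin t * p.1 + cos t * p.2).

Definition homeomorphism_between (S T : topologicalType)
    (A : set S) (B : set T) (f : S -> T) (g : T -> S) : Prop :=
  [/\ set_fun A B f,
      set_fun B A g,
      forall x, A x -> g (f x) = x,
      forall y, B y -> f (g y) = y
    & {within A, continuous f} /\ {within B, continuous g}].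

Definition conjugate_on (S T : topologicalType)
    (A : set S) (u : S -> S) (B : set T) (v : T -> T) : Prop :=
  [/\ set_fun A A u, set_fun B B v
    & exists f g, homeomorphism_between A B f g /\
                  forall x, A x -> f (u x) = v (f x)].

(* A conjugacy, possibly reversing the orientation, determines the rotation
   number only up to sign and modulo 1; the bounds select the representative
   in [0, 1/2]. *)
Definition has_rotation_number (R : realType)
    (A : set (R * R)) (u : R * R -> R * R) (theta : R) : Prop :=
  0 <= theta <= 2^-1 /\
  conjugate_on A u (@circle R) (rotation (2 * pi * theta)).

(* Here x is the abscissa of the fixed point. *)
Definition sigma (R : realType) (a b x : R) : R :=
  (2 * pi)^-1 * acos (2^-1 * (-1 - (a + b * x) / (x * (b + x)))).

(* Main.v *)
(* The map F permutes the points of the cubic V = h by a horizontal switch of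
   the two intersections with a horizontal line followed by a vertical switch,
   and it preserves the Hamiltonian vector field of the biquadratic polynomial
   A(x) y^2 + B(x) y + C(x) that cuts out the oval.  That field turns an oval
   into a periodic orbit of period T, on which F is therefore the time t1 map:
   F is conjugate to the rotation of number t1 / T.  Over an oval, x ranges over
   an interval [p, q] with p < x_c < q, and x = m - d cos phi (m and d the
   midpoint and half-length of [p, q]) regularizes the time dx / sqrt (B^2 - 4AC)
   into a positive continuous density in phi, which makes t1 / T a continuous
   function of p in ]0, x_c[.  As p tends to x_c the density becomes constant and
   t1 / T tends to sigma(a, b).  As p tends to 0, h tends to infinity; the abscissas of
   F^2 and F^3 of the leftmost point stay bounded away from 0 and infinity, a
   region which the flow crosses in time O(1 / h), whereas h T is unbounded, so
   5 t1 - 2 T = o(T) and t1 / T tends to 2/5.  The intermediate value theorem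
   concludes. *)
Require Import Defs.
From mathcomp Require Import all_boot all_order all_algebra.
From mathcomp Require Import all_classical all_reals all_analysis.
From mathcomp Require Import ring lra.
Import Order.TTheory GRing.Theory Num.Theory.
Import numFieldNormedType.Exports.

Set Implicit Arguments.
Unset Strict Implicit.
Unset Printing Implicit Defensive.

Local Open Scope classical_set_scope.
Local Open Scope ring_scope.

(** Separating variables gives the time as an integral of dx / sqrt (B^2 - 4AC), singular at p and
    q, where the scalar equation x' = sqrt (B^2 - 4AC) also loses uniqueness. In the angle phi
    nothing is singular: the flow is the inverse of a primitive, so that its existence is explicit,
    and uniqueness is asked only of the polynomial field in the plane. The field is invariant
    because on the level h it equals x y (V_y, - V_x), the Hamiltonian field of V for the area form
    dx dy / (x y); each of the two switches preserves V and reverses that form. Taking p rather than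
    h as parameter spares inverting the level on the left of x_c. The density still makes sense at p
    = q = x_c, where there is no oval, so the limit there and the continuity inside are two
    instances of one convergence statement. As p tends to 0 the level blows up, and travel times are
    compared instead. *)

(** * Primitives of periodic functions *)

Section Calculus.
Context {R : realType}.
Implicit Types (f g : R -> R) (x : R).

Lemma is_derive_add f g x df dg : is_derive x 1 f df -> is_derive x 1 g dg ->
  is_derive x 1 (fun t => f t + g t) (df + dg).
Proof. exact: is_deriveD. Qed.

Lemma is_derive_sub f g x df dg : is_derive x 1 f df -> is_derive x 1 g dg ->
  is_derive x 1 (fun t => f t - g t) (df - dg).
Proof. exact: is_deriveB. Qed.

Lemma is_derive_const (c x : R) : is_derive x 1 (fun=> c) 0.
Proof. exact: (is_derive_cst c x 1). Qed.

Lemma is_derive_ident x : is_derive x 1 (fun t => t) 1.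
Proof. exact: is_derive_id. Qed.

Lemma is_derive_opp f x df : is_derive x 1 f df ->
  is_derive x 1 (fun t => - f t) (- df).
Proof. exact: is_deriveN. Qed.

Lemma is_derive_mul f g x df dg : is_derive x 1 f df -> is_derive x 1 g dg ->
  is_derive x 1 (fun t => f t * g t) (df * g x + f x * dg).
Proof.
move=> hf hg; apply: (is_derive_eq (is_deriveM hf hg)).
by rewrite /GRing.scale /=; ring.
Qed.

Lemma is_derive_inv f x df : f x != 0 -> is_derive x 1 f df ->
  is_derive x 1 (fun t => (f t)^-1) (- df / f x ^+ 2).
Proof.
move=> f0 hf; apply: (is_derive_eq (is_deriveV f0 hf)).
by rewrite /GRing.scale /=; field.
Qed.

Lemma is_derive_comp f g x a b : is_derive (g x) 1 f a -> is_derive x 1 g b ->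
  is_derive x 1 (fun t => f (g t)) (a * b).
Proof. exact: is_derive1_comp. Qed.

Lemma is_derive_continuous f x df : is_derive x 1 f df -> {for x, continuous f}.
Proof.
by move=> [hf _]; apply/differentiable_continuous/derivable1_diffP.
Qed.

Lemma mean_value f df (a b : R) : a <= b ->
  (forall x, a <= x <= b -> is_derive x 1 f (df x)) ->
  exists2 c, a <= c <= b & f b - f a = df c * (b - a).
Proof.
move=> ab hf.
have [| |c cab E] := @MVT_segment R f df a b ab.
- by move=> x; rewrite in_itv /= => /andP[/ltW ax /ltW xb]; apply: hf; rewrite ax.
- apply: continuous_in_subspaceT => x; rewrite inE /= in_itv /= => xab.
  exact: is_derive_continuous (hf x xab).
- by exists c => //; move: cab; rewrite in_itv.
Qed.

Lemma primitive_exists f : continuous f ->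
  exists F, F 0 = 0 /\ forall x, is_derive x 1 F (f x).
Proof.
move=> cf.
pose mu := @lebesgue_measure R.
have fint a b : mu.-integrable `[a, b] (EFin \o f).
  apply: continuous_compact_integrable; first exact: segment_compact.
  exact: continuous_subspaceT.
pose G (n x : R) := \int[mu]_(t in `[- n, x]) f t.
(* The integral starts at a finite bound that has to lie to the left of x and 0. By [indep] the
   difference does not depend on that bound, which can therefore be frozen near each x. *)
pose F x := G (`|x| + 1) x - G (`|x| + 1) 0.
have indep (n m x : R) : `|x| < n -> `|x| < m -> G n x - G n 0 = G m x - G m 0.
  move=> nx mx.
  have n0 : 0 < n := le_lt_trans (normr_ge0 x) nx.
  have m0 : 0 < m := le_lt_trans (normr_ge0 x) mx.
  have [x0|/ltW x0] := leP 0 x.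
  - rewrite /G.
    rewrite !Rintegral_itvB ?bnd_simp //; last 2 first.
      by rewrite /= oppr_le0 ltW.
    by rewrite /= oppr_le0 ltW.
  - rewrite -[LHS]opprB -[RHS]opprB; congr (- _).
    rewrite /G !Rintegral_itvB ?bnd_simp //.
      by apply: ltW; move: mx; rewrite ltr_norml => /andP[].
    by apply: ltW; move: nx; rewrite ltr_norml => /andP[].
exists F; split; first by rewrite /F subrr.
move=> x.
pose n : R := `|x| + 2.
have nx : - n < x.
  by have : `|x| < n; [rewrite /n ltrDl | rewrite ltr_norml => /andP[]].
have x1 : x < x + 1 by rewrite ltrDl.
have [dG eG] := continuous_FTC1_closed x1 (fint (- n) (x + 1)) nx (cf x).
apply: (@near_eq_is_derive _ _ _ (fun y => G n y - G n 0)).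
  have : \forall y \near x, `|x - y| < 1 by exact: (@nbhsx_ballx R R x 1 ltr01).
  apply: filterS => y xy; rewrite /F; apply: indep; last by rewrite ltrDl.
  rewrite -[y](subKr x) (le_lt_trans (ler_normB _ _))// /n.
  by rewrite [2]mulr2n addrA ler_ltD// ler_wpDr.
rewrite -[f x]subr0; refine (is_derive_sub _ (is_derive_const _ _)).
by apply: DeriveDef; [exact: dG | rewrite -derive1E; exact: eG].
Qed.


Lemma is_derive_zero f (a b : R) : (forall x, is_derive x 1 f 0) -> f a = f b.
Proof. by move=> hf; exact: is_derive_0_is_cst. Qed.

(* The zero function when [f] has no primitive. *)
Definition primitive f : R -> R :=
  xget (fun=> 0) [set F | F 0 = 0 /\ forall x, is_derive x 1 F (f x)].

Lemma primitive_spec f : continuous f ->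
  primitive f 0 = 0 /\ forall x, is_derive x 1 (primitive f) (f x).
Proof.
move=> /primitive_exists[F hF]; rewrite /primitive.
by case: xgetP => [G _ //|/(_ F)]; case.
Qed.

Section PeriodicPrimitive.
Variables (w : R -> R) (P : R).
Hypotheses (cw : continuous w) (w_gt0 : forall x, 0 < w x)
  (w_even : forall x, w (- x) = w x) (P_gt0 : 0 < P)
  (w_per : forall x, w (x + P) = w x).
Let W := primitive w.

Let W0 : W 0 = 0. Proof. by case: (primitive_spec cw). Qed.
Let dW x : is_derive x 1 W (w x).
Proof. by case: (primitive_spec cw) => _; exact. Qed.

Lemma primitive_le : {mono W : x y / x <= y}.
Proof.
apply: le_mono => x y xy.
have [z _ E] := mean_value (ltW xy) (fun z _ => dW z).
by rewrite -subr_gt0 E mulr_gt0 // subr_gt0.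
Qed.

Lemma primitive_lt : {mono W : x y / x < y}.
Proof. exact: leW_mono primitive_le. Qed.

Lemma primitive_odd x : W (- x) = - W x.
Proof.
apply/eqP; rewrite -subr_eq0 opprK; apply/eqP.
transitivity (W (- 0) + W 0); last by rewrite oppr0 W0 addr0.
apply: (is_derive_zero (f := fun x => W (- x) + W x)) => y.
have dWN : is_derive y 1 (fun t => W (- t)) (w (- y) * - 1).
  exact: (is_derive_comp (g := fun t => - t) (dW _) (is_derive_opp (is_derive_ident _))).
apply: (is_derive_eq (is_derive_add dWN (dW _))).
by rewrite w_even mulrN1 addNr.
Qed.

Lemma primitive_shift x : W (x + P) = W x + W P.
Proof.
apply/eqP; rewrite -subr_eq0 opprD addrA subr_eq0; apply/eqP.
transitivity (W (0 + P) - W 0); last by rewrite add0r W0 subr0.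
apply: (is_derive_zero (f := fun x => W (x + P) - W x)) => y.
have dWP : is_derive y 1 (fun t => W (t + P)) (w (y + P) * (1 + 0)).
  have dP := is_derive_add (is_derive_ident y) (is_derive_const P y).
  exact: (is_derive_comp (g := fun t => t + P) (dW _) dP).
apply: (is_derive_eq (is_derive_sub dWP (dW _))).
by rewrite w_per addr0 mulr1 subrr.
Qed.

Lemma primitive_half : W P = W (P / 2) *+ 2.
Proof.
have := primitive_shift (- (P / 2)); rewrite primitive_odd.
have -> : - (P / 2) + P = P / 2 by field.
by move=> /eqP; rewrite addrC -subr_eq opprK => /eqP <-; rewrite mulr2n.
Qed.

Lemma primitive_shiftn x n : W (x + P *+ n) = W x + W P *+ n.
Proof.
elim: n => [|n IH]; first by rewrite !mulr0n !addr0.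
by rewrite !mulrSr !addrA primitive_shift IH.
Qed.

Lemma primitive_period_gt0 : 0 < W P.
Proof. by rewrite -W0 primitive_lt. Qed.

Lemma primitive_surj y : exists x, W x = y.
Proof.
have T0 := primitive_period_gt0.
pose n := Num.bound (y / W P).
have ny : `|y| < W P *+ n.
  rewrite -mulr_natr mulrC -ltr_pdivrMr //.
  have := archi_boundP (normr_ge0 (y / W P)).
  by rewrite /n /Num.bound normr_id normrM normfV (gtr0_norm T0).
have Wn : W (P *+ n) = W P *+ n.
  by have := primitive_shiftn 0 n; rewrite W0 !add0r.
have [|||x _ E] := @IVT R W (- (P *+ n)) (P *+ n) y.
- by rewrite -subr_ge0 opprK addr_ge0 // mulrn_wge0 // ltW.
- by apply: continuous_subspaceT => x; exact: is_derive_continuous (dW x).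
- rewrite primitive_odd Wn ge_min le_max.
  by move: ny; rewrite ltr_norml => /andP[/ltW -> /ltW ->]; rewrite orbT.
by exists x.
Qed.

Lemma primitive_inverse : exists phi, [/\ cancel W phi, cancel phi W &
  forall t : R, is_derive t 1 phi (w (phi t))^-1].
Proof.
have [phi hphi] := choice primitive_surj.
have Wphi : cancel W phi.
  by move=> x; exact: (inc_inj primitive_le).
exists phi; split => // t.
rewrite -{1}(hphi t); apply: is_derive_inverse (dW _) _.
- by near=> x; exact: Wphi.
- by near=> x; exact: is_derive_continuous (dW _).
- exact: lt0r_neq0.
Unshelve. all: by end_near.
Qed.

End PeriodicPrimitive.

End Calculus.

(** * Maps of the circle *)

Section Circle.
Context {R : realType}.

Lemma periodic_int (U : Type) (G : R -> U) (P : R) :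
  (forall t, G (t + P) = G t) -> forall t (k : int), G (t + P *~ k) = G t.
Proof.
move=> G_per.
have nat_per n u : G (u + P *+ n) = G u.
  elim: n u => [|n IH] u; first by rewrite mulr0n addr0.
  by rewrite mulrSr addrA G_per IH.
move=> t [] n; first exact: nat_per.
by rewrite NegzE mulrNz -(nat_per n.+1 (t - _)) subrK.
Qed.

Lemma cosD2piE (t : R) : cos (t + 2 * pi) = cos t.
Proof. by rewrite mulr_natl cosD2pi. Qed.

Lemma sinD2piE (t : R) : sin (t + 2 * pi) = sin t.
Proof. by rewrite mulr_natl sinD2pi. Qed.

Lemma cos_eq1 (u : R) : cos u = 1 -> exists k : int, u = (2 * pi) *~ k.
Proof.
move=> cu; exists (Num.floor (u / (2 * pi))).
have pi0 := pi_gt0 R.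
have tp0 : 0 < 2 * pi :> R by rewrite mulr_gt0.
set k := Num.floor _; pose v := u - (2 * pi) *~ k.
suff v0 : v = 0 by apply/eqP; rewrite -subr_eq0 -/v v0.
have cv : cos v = 1 by rewrite /v -mulrNz (periodic_int cosD2piE).
have /andP[v0 v2] : 0 <= v < 2 * pi.
  have /andP[] := floor_itv (u / (2 * pi)); rewrite -/k.
  rewrite ler_pdivlMr // ltr_pdivrMr // intrD => k1 k2.
  by rewrite /v -mulrzr; apply/andP; split; nra.
have [vpi|piv] := leP v pi.
  by apply: cos_inj; rewrite ?in_itv /= ?v0 ?vpi ?lexx ?ltW // cv cos0.
have vE : 2 * pi - v = 0.
  apply: cos_inj; last first.
    by rewrite addrC cosD2piE cosN cv cos0.
    by rewrite in_itv /= lexx ltW.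
  by rewrite !in_itv /=; apply/andP; split; lra.
lra.
Qed.

Definition circle_arg (z : R * R) : R :=
  if 0 <= z.2 then acos z.1 else - acos z.1.

Lemma circle_argK z : circle z -> (cos (circle_arg z), sin (circle_arg z)) = z.
Proof.
case: z => c s; rewrite /circle /circle_arg /= => E.
have c1 : -1 <= c <= 1.
  by apply/andP; split; nra.
have S : Num.sqrt (1 - c ^+ 2) = `|s|.
  by rewrite -E addrC addKr sqrtr_sqr.
case: ifPn => [s0|]; [|rewrite -ltNge => s0].
  by rewrite acosK ?in_itv //= sin_acos // S ger0_norm.
by rewrite cosN sinN acosK ?in_itv //= sin_acos // S ltr0_norm // opprK.
Qed.

Section PeriodicMap.
Context {U : topologicalType} (G : R -> U).
Hypotheses (G_per : forall t, G (t + 2 * pi) = G t).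

Lemma periodic_cos_sin u v : cos u = cos v -> sin u = sin v -> G u = G v.
Proof.
move=> cuv suv.
have [k E] : exists k : int, u - v = (2 * pi) *~ k.
  by apply: cos_eq1; rewrite cosB cuv suv -!expr2 cos2Dsin2.
by rewrite -(periodic_int G_per v k) -E addrC subrK.
Qed.

Lemma circle_argE t : G (circle_arg (cos t, sin t)) = G t.
Proof.
have /circle_argK[] : circle (cos t, sin t) by exact: cos2Dsin2.
exact: periodic_cos_sin.
Qed.

(* Near [z0], an argument is [circle_arg z0] plus the arcsine of a cross product,
   which avoids the discontinuity of [circle_arg]. *)
Lemma circle_map_continuous : continuous G ->
  {within @circle R, continuous (G \o circle_arg)}.
Proof.
move=> cG; apply/subspace_continuousP => z0 z0circle.
set f0 := circle_arg z0.
pose dt (z : R * R) := z.2 * z0.1 - z.1 * z0.2.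
pose ip (z : R * R) := z.1 * z0.1 + z.2 * z0.2.
have cdt : continuous dt.
  move=> z; apply: cvgB; apply: cvgMl; [exact: cvg_snd|exact: cvg_fst].
have cip : continuous ip.
  move=> z; apply: cvgD; apply: cvgMl; [exact: cvg_fst|exact: cvg_snd].
have dt0 : dt z0 = 0 by rewrite /dt mulrC subrr.
have ip0 : ip z0 = 1 by rewrite /ip -!expr2.
pose h (z : R * R) := G (f0 + asin (dt z)).
have hz0 : (G \o circle_arg) z0 = h z0.
  have pi0 := pi_ge0 R.
  rewrite /h dt0 -sin0 sinK ?addr0 // in_itv /=.
  by apply/andP; split; lra.
suff: (G \o circle_arg) x @[x --> within (@circle R) (nbhs z0)] -->
    (G \o circle_arg) z0 by [].
rewrite hz0.
apply: (@cvg_trans _ (h @ within (@circle R) (nbhs z0))).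
  apply: near_eq_cvg; rewrite near_withinE.
  (* [dt z] and [ip z] are the sine and cosine of the angle from z0 to z. Where [ip] is positive,
     this angle lies within pi / 2 of 0 and the arcsine recovers it. *)
  have : \forall z \near z0, 0 < ip z.
    by have /cvgr_gt := cip z0; apply; rewrite ip0.
  apply: filterS => z ipz zc.
  have /= := circle_argK z0circle.
  move=> E0; have f0c := congr1 fst E0; have f0s := congr1 snd E0;
  rewrite /= -/f0 in f0c f0s.
  have zz : dt z ^+ 2 + ip z ^+ 2 = 1.
    transitivity ((z.1 ^+ 2 + z.2 ^+ 2) * (z0.1 ^+ 2 + z0.2 ^+ 2)).
      by rewrite /dt /ip; ring.
    by rewrite zc z0circle mul1r.
  have dt1 : -1 <= dt z <= 1 by apply/andP; split; nra.
  have sa : sin (asin (dt z)) = dt z by rewrite asinK // in_itv.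
  have ca : cos (asin (dt z)) = ip z.
    by rewrite cos_asin // -zz addrAC subrr add0r sqrtr_sqr gtr0_norm.
  have Ez := circle_argK zc; have zc1 := congr1 fst Ez; have zc2 := congr1 snd Ez.
  rewrite /= in zc1 zc2.
  rewrite /from_subspace /h /=; apply: periodic_cos_sin.
    rewrite zc1 cosD ca sa f0c f0s.
    transitivity (z.1 * (z0.1 ^+ 2 + z0.2 ^+ 2)); first by rewrite /dt /ip; ring.
    by rewrite z0circle mulr1.
  rewrite zc2 sinD ca sa f0c f0s.
  transitivity (z.2 * (z0.1 ^+ 2 + z0.2 ^+ 2)); first by rewrite /dt /ip; ring.
  by rewrite z0circle mulr1.
apply: cvg_within_filter.
apply: (@continuous_comp _ _ _ (fun z => f0 + asin (dt z)) G); last exact: cG.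
apply: cvgD; first exact: cvg_cst.
apply: continuous_comp; first exact: cdt.
by apply: continuous_asin; rewrite dt0 ltrN10 ltr01.
Qed.

End PeriodicMap.
End Circle.

(** * The equation x'^2 = (x - p) (q - x) E(x) with E quadratic *)

Section QuadraticClock.
Context {R : realType}.

Definition midpoint (p q : R) := (p + q) / 2.
Definition halfwidth (p q : R) := (q - p) / 2.
Definition quadratic (e0 e1 e2 x : R) := e0 + e1 * x + e2 * x ^+ 2.
Definition abscissa (p q phi : R) := midpoint p q - halfwidth p q * cos phi.

(* With x = abscissa phi, this is dt / dphi for dx / dt = sqrt ((x - p) (q - x) E(x)),
   where E has coefficients e0, e1, e2. *)
Definition clock_density (p q e0 e1 e2 phi : R) :=
  (Num.sqrt (quadratic e0 e1 e2 (abscissa p q phi)))^-1.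

Variables p q e0 e1 e2 : R.
Hypothesis pq : p < q.
Local Notation E := (quadratic e0 e1 e2).
Hypothesis E_gt0 : forall x, p <= x <= q -> 0 < E x.
Local Notation m := (midpoint p q).
Local Notation d := (halfwidth p q).
Local Notation X := (abscissa p q).
Local Notation w := (clock_density p q e0 e1 e2).
Local Notation W := (primitive w).

Let d_gt0 : 0 < d.
Proof. by rewrite /d divr_gt0 // subr_gt0. Qed.

Lemma abscissa_bounds phi : p <= X phi <= q.
Proof.
have := cos_geN1 phi; have := cos_le1 phi; have := pq.
by rewrite /abscissa /midpoint /halfwidth => *; apply/andP; split; nra.
Qed.

Lemma is_derive_abscissa (phi : R) : is_derive phi 1 X (d * sin phi).
Proof.
have dcos := is_derive_mul (is_derive_const d phi) (is_derive_cos phi).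
apply: (is_derive_eq (is_derive_sub (is_derive_const m phi) dcos)).
by ring.
Qed.

Lemma is_derive_quadratic (x : R) : is_derive x 1 E (e1 + 2 * e2 * x).
Proof.
have dx := is_derive_ident x.
have d1 := is_derive_mul (is_derive_const e1 x) dx.
have d2 := is_derive_mul (is_derive_const e2 x) (is_derive_mul dx dx).
apply: (is_derive_eq (is_derive_add (is_derive_add (is_derive_const e0 x) d1) d2)).
ring.
Qed.

Let is_derive_EX (phi : R) : is_derive phi 1 (fun t => E (X t))
  ((e1 + 2 * e2 * X phi) * (d * sin phi)).
Proof. exact: is_derive_comp (is_derive_quadratic _) (is_derive_abscissa _). Qed.

Let EX_gt0 phi : 0 < E (X phi).
Proof. exact/E_gt0/abscissa_bounds. Qed.

Let sE_gt0 phi : 0 < Num.sqrt (E (X phi)).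
Proof. by rewrite sqrtr_gt0. Qed.

Lemma clock_density_gt0 phi : 0 < w phi.
Proof. by rewrite invr_gt0. Qed.

Lemma clock_density_even phi : w (- phi) = w phi.
Proof. by rewrite /clock_density /abscissa cosN. Qed.

Lemma clock_density_periodic phi : w (phi + 2 * pi) = w phi.
Proof. by rewrite /clock_density /abscissa cosD2piE. Qed.

Lemma clock_density_continuous : continuous w.
Proof.
move=> phi; apply: cvgV; first by rewrite gt_eqF.
apply: continuous_comp; last exact: sqrt_continuous.
exact: is_derive_continuous (is_derive_EX phi).
Qed.

Let cw := clock_density_continuous.
Let tpi_gt0 : 0 < 2 * pi :> R. Proof. by rewrite mulr_gt0 ?pi_gt0. Qed.

Definition angle_at_time : R -> R :=
  xget (fun=> 0) [set phi : R -> R | [/\ cancel W phi, cancel phi W &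
    forall t : R, is_derive t 1 phi (w (phi t))^-1]].
Local Notation phi := angle_at_time.

Lemma angle_at_time_spec : [/\ cancel W phi, cancel phi W &
  forall t : R, is_derive t 1 phi (Num.sqrt (E (X (phi t))))].
Proof.
have [f hf] := primitive_inverse cw clock_density_gt0 clock_density_even
  tpi_gt0 clock_density_periodic.
rewrite /angle_at_time; case: xgetP => [f' _|/(_ f)] //=.
by move=> [f1 f2 f3]; split=> // t; have := f3 t; rewrite invrK.
Qed.

Definition flow_x (t : R) := X (phi t).
Definition flow_r (t : R) := d * sin (phi t) * Num.sqrt (E (X (phi t))).

Lemma flow_x_bounds t : p <= flow_x t <= q.
Proof. exact: abscissa_bounds. Qed.

Lemma flow_r_sqr t :
  flow_r t ^+ 2 = (flow_x t - p) * (q - flow_x t) * E (flow_x t).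
Proof.
rewrite /flow_r exprMn sqr_sqrtr ?ltW // exprMn sin2cos2.
by congr (_ * _); rewrite /flow_x /abscissa /midpoint /halfwidth; field.
Qed.

Lemma is_derive_flow_x (t : R) : is_derive t 1 flow_x (flow_r t).
Proof.
have [_ _ dphi] := angle_at_time_spec.
exact: is_derive_comp (is_derive_abscissa _) (dphi t).
Qed.

(** The value is half the x-derivative of (x - p) (q - x) E(x). Differentiating [flow_r_sqr] would
    give it only where [flow_r] is nonzero; differentiating the expression in the angle covers the
    turning points as well. *)
Lemma is_derive_flow_r (t : R) : is_derive t 1 flow_r
  ((m - flow_x t) * E (flow_x t) +
   (flow_x t - p) * (q - flow_x t) * (e1 + 2 * e2 * flow_x t) / 2).
Proof.
have [_ _ dphi] := angle_at_time_spec.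
have ds := is_derive_comp (is_derive_sin _) (dphi t).
have dE := is_derive_comp (is_derive_EX _) (dphi t).
have dsE := is_derive_comp (g := fun s => E (X (phi s)))
  (is_derive1_sqrt (EX_gt0 _)) dE.
have dS := is_derive_mul (is_derive_mul (is_derive_const d t) ds) dsE.
apply: (is_derive_eq dS).
have S0 := lt0r_neq0 (sE_gt0 (phi t)).
have E2 := sqr_sqrtr (ltW (EX_gt0 (phi t))).
rewrite -!/(flow_x t) /= in S0 E2 *.
move: (Num.sqrt _) S0 E2 => S S0 <-.
have -> : (flow_x t - p) * (q - flow_x t) = d ^+ 2 * sin (phi t) ^+ 2.
  by rewrite sin2cos2 /flow_x /abscissa /midpoint /halfwidth; field.
have -> : m - flow_x t = d * cos (phi t).
  by rewrite /flow_x /abscissa opprB addrC subrK.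
by field.
Qed.

Local Notation T := (W (2 * pi)).

Lemma clock_period_gt0 : 0 < T.
Proof. exact: primitive_period_gt0 cw clock_density_gt0 tpi_gt0. Qed.

Lemma angle_odd t : phi (- t) = - phi t.
Proof.
have [f1 f2 _] := angle_at_time_spec.
by rewrite -{1}(f2 t) -(primitive_odd cw clock_density_even) f1.
Qed.

Lemma angle_shift t : phi (t + T) = phi t + 2 * pi.
Proof.
have [f1 f2 _] := angle_at_time_spec.
by rewrite -{1}(f2 t) -(primitive_shift cw clock_density_periodic) f1.
Qed.

Lemma flow_x_even t : flow_x (- t) = flow_x t.
Proof. by rewrite /flow_x angle_odd /abscissa cosN. Qed.

Lemma flow_x_periodic t : flow_x (t + T) = flow_x t.
Proof. by rewrite /flow_x angle_shift /abscissa cosD2piE. Qed.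

Lemma flow_r_periodic t : flow_r (t + T) = flow_r t.
Proof. by rewrite /flow_r angle_shift /abscissa cosD2piE sinD2piE. Qed.

Lemma clock_half : W pi = T / 2.
Proof.
have -> := primitive_half cw clock_density_even clock_density_periodic.
have -> : 2 * pi / 2 = pi :> R by field.
by field.
Qed.

Lemma primitive_clock0 : W 0 = 0.
Proof. by case: (primitive_spec cw). Qed.

Lemma angle_bounds t : 0 < t < T / 2 -> 0 < phi t < pi.
Proof.
have [f1 f2 _] := angle_at_time_spec.
rewrite -clock_half -{1 2}(f2 t) -{1}primitive_clock0.
by rewrite !(primitive_lt cw clock_density_gt0).
Qed.

Lemma flow_r_gt0 t : 0 < t < T / 2 -> 0 < flow_r t.
Proof.
by move=> /angle_bounds /sin_gt0_pi s0; apply: mulr_gt0 (sE_gt0 _); apply: mulr_gt0.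
Qed.

Lemma flow_x_start : flow_x 0 = p.
Proof.
have [f1 _ _] := angle_at_time_spec.
rewrite /flow_x -primitive_clock0 f1 /abscissa cos0 /midpoint /halfwidth.
by field.
Qed.

Lemma flow_x_half : flow_x (T / 2) = q.
Proof.
have [f1 _ _] := angle_at_time_spec.
rewrite /flow_x -clock_half f1 /abscissa cospi /midpoint /halfwidth.
by field.
Qed.

End QuadraticClock.

(** * The invariant curve *)

Section Curve.
Context {R : realType}.
Variables a b : R.
Hypotheses (ha : 0 < a) (hb : 0 < b).

(* V(x, y) = h reads A y^2 + B y + C = 0. *)
Definition curveA (x : R) := a * b * (b * x + a).
Definition curveB (h x : R) :=
  (b * x + a) * (a ^+ 2 * x + a ^+ 2 * b + b ^+ 2) - h * x.
Definition curveC (x : R) := a * b * (b * x + a) * (x + b).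
Definition discriminant h x := curveB h x ^+ 2 - 4 * curveA x * curveC x.
(* The discriminant B^2 - 4AC vanishes where turning x = h x, see [discriminantE]. *)
Definition turning (x : R) := (b * x + a) * (a * Num.sqrt (x + b) + b) ^+ 2.

Lemma curveA_gt0 x : 0 < x -> 0 < curveA x.
Proof. by move=> x0; rewrite /curveA !mulr_gt0 // addr_gt0 // mulr_gt0. Qed.

Lemma curveC_gt0 x : 0 < x -> 0 < curveC x.
Proof. by move=> x0; rewrite /curveC !mulr_gt0 // addr_gt0 // mulr_gt0. Qed.

Lemma Vinv_eqE h x y : 0 < x -> 0 < y ->
  Vinv b a (x, y) = h <-> curveA x * y ^+ 2 + curveB h x * y + curveC x = 0.
Proof.
move=> x0 y0; have /lt0r_neq0 xy0 := mulr_gt0 x0 y0.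
have E : curveA x * y ^+ 2 + curveB h x * y + curveC x =
    (Vinv b a (x, y) - h) * (x * y).
  by rewrite /Vinv /curveA /curveB /curveC /=; field; rewrite !lt0r_neq0.
rewrite E; split=> [->|]; first by rewrite subrr mul0r.
by move/eqP; rewrite mulf_eq0 (negbTE xy0) orbF subr_eq0 => /eqP.
Qed.

Lemma sqrt_shift_gt0 x : 0 < x -> 0 < Num.sqrt (x + b).
Proof. by move=> x0; rewrite sqrtr_gt0 addr_gt0. Qed.

Lemma sqrt_shift_sqr x : 0 < x -> Num.sqrt (x + b) ^+ 2 = x + b.
Proof. by move=> x0; rewrite sqr_sqrtr // ltW // addr_gt0. Qed.

Lemma curveB_turning h x : 0 < x -> curveB h x =
  turning x - h * x - 2 * a * b * (b * x + a) * Num.sqrt (x + b).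
Proof.
move=> x0; rewrite /curveB /turning.
have := sqrt_shift_sqr x0; set s := Num.sqrt _ => s2.
transitivity ((b * x + a) * (a ^+ 2 * (x + b) + b ^+ 2) - h * x); first ring.
by rewrite -s2; ring.
Qed.

(** Since [curveC x] is [curveA x * (x + b)], the product AC is the square of a b (b x + a) sqrt (x
    + b), and B^2 - 4AC splits as a difference of squares, with B + 2 sqrt (AC) = turning x - h
    x. *)
Lemma discriminantE h x : 0 < x -> discriminant h x =
  (h * x - turning x) *
  (h * x - turning x + 4 * a * b * (b * x + a) * Num.sqrt (x + b)).
Proof.
move=> x0; rewrite /discriminant curveB_turning //.
have -> : curveC x = a * b * (b * x + a) * Num.sqrt (x + b) ^+ 2.
  by rewrite sqrt_shift_sqr.
by rewrite /curveA; ring.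
Qed.

Lemma Fmap_oval h z : oval b a h z -> oval b a h (Fmap b a z).
Proof.
case: z => x y [[/= x0 y0] V]; split; first split => /=.
- by rewrite divr_gt0 // addr_gt0.
- by rewrite divr_gt0 ?mulr_gt0 // !addr_gt0 // mulr_gt0.
rewrite -V /Vinv /Fmap /=; field.
have bx := mulr_gt0 hb x0.
by rewrite !lt0r_neq0 //= !addr_gt0.
Qed.

(* The discriminant is a quartic in x with leading coefficient a^4 b^2, and [discr3],
   [discr2] are its next two coefficients. When p and q are roots, [quot] is its
   quotient by (x - p) (q - x). *)
Definition quot2 : R := - (a ^+ 4 * b ^+ 2).
Definition discr3 h : R :=
  2 * (a ^+ 2 * b) * (a ^+ 3 + b * (a ^+ 2 * b + b ^+ 2) - h)
  - 4 * a ^+ 2 * b ^+ 4.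
Definition discr2 h : R :=
  (a ^+ 3 + b * (a ^+ 2 * b + b ^+ 2) - h) ^+ 2
  + 2 * (a ^+ 2 * b) * (a * (a ^+ 2 * b + b ^+ 2))
  - 4 * a ^+ 2 * b ^+ 2 * (2 * a * b + b ^+ 3).
Definition quot1 h p q := - (discr3 h + a ^+ 4 * b ^+ 2 * (p + q)).
Definition quot0 h p q := - (discr2 h + discr3 h * (p + q)
  + a ^+ 4 * b ^+ 2 * (p ^+ 2 + p * q + q ^+ 2)).
Definition quot h p q := quadratic (quot0 h p q) (quot1 h p q) quot2.

Lemma quotC h p q x : quot h p q x = quot h q p x.
Proof. by rewrite /quot /quadratic /quot0 /quot1; ring. Qed.

(** Linear interpolation at p and q, with its remainder. Without assuming that p and q are roots,
    this is a polynomial identity. *)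
Lemma discriminant_interpolation h p q x :
  (q - p) * discriminant h x =
  discriminant h p * (q - x) + discriminant h q * (x - p)
  + (q - p) * ((x - p) * (q - x) * quot h p q x).
Proof.
rewrite /discriminant /curveA /curveB /curveC /quot /quadratic.
by rewrite /quot0 /quot1 /quot2 /discr2 /discr3; ring.
Qed.

Definition curveB' (h x : R) :=
  b * (a ^+ 2 * x + a ^+ 2 * b + b ^+ 2) + (b * x + a) * a ^+ 2 - h.

(** The x-derivative of both sides of [discriminant_interpolation]. *)
Lemma discriminant_interpolation_derive h p q x :
  (q - p) * (2 * curveB h x * curveB' h x - 4 * (a * b * b * curveC x
    + curveA x * (a * b * (2 * b * x + b ^+ 2 + a)))) =
  discriminant h q - discriminant h p
  + (q - p) * ((p + q - 2 * x) * quot h p q x +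
     (x - p) * (q - x) * (quot1 h p q + 2 * quot2 * x)).
Proof.
rewrite /discriminant /curveA /curveB /curveB' /curveC /quot /quadratic.
by rewrite /quot0 /quot1 /quot2 /discr2 /discr3; ring.
Qed.

Lemma discriminant_root h x : 0 < x -> turning x = h * x ->
  discriminant h x = 0.
Proof. by move=> x0 E; rewrite discriminantE // E subrr mul0r. Qed.

Lemma discriminant_factor h p q x : 0 < p -> 0 < q -> p != q ->
  turning p = h * p -> turning q = h * q ->
  discriminant h x = (x - p) * (q - x) * quot h p q x.
Proof.
move=> p0 q0 pq Hp Hq.
apply: (@mulfI _ (q - p)); first by rewrite subr_eq0 eq_sym.
by rewrite discriminant_interpolation !discriminant_root // !mul0r !add0r.
Qed.

(** (q - p) quot(p) is the derivative of the discriminant at p. Eliminating h through turning p = h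
    p leaves the factor a + s - p^2, which vanishes at x_c. The order of p and q is left open so
    that the lemma also applies at the right end. *)
Lemma quot_endpoint h p q : 0 < p -> 0 < q -> p != q ->
  turning p = h * p -> turning q = h * q ->
  let s := Num.sqrt (p + b) in
  p * (q - p) * quot h p q p =
  4 * a ^+ 2 * b ^+ 2 * (b * p + a) * (a * s + b) * (a + s - p ^+ 2).
Proof.
move=> p0 q0 pq Hp Hq s.
have s0 : 0 < s := sqrt_shift_gt0 p0.
have s2 : s ^+ 2 = p + b := sqrt_shift_sqr p0.
apply: (@mulfI _ (q - p)); first by rewrite subr_eq0 eq_sym.
pose D' := 2 * curveB h p * (b * (a ^+ 2 * p + a ^+ 2 * b + b ^+ 2)
   + (b * p + a) * a ^+ 2 - h)
   - 4 * (a * b) ^+ 2 * (b * p + a) * (2 * b * (p + b) + (b * p + a)).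
have E : (q - p) ^+ 2 * quot h p q p =
    (q - p) * D' - discriminant h q + discriminant h p.
  rewrite /D' /discriminant /curveA /curveB /curveC /quot /quadratic.
  by rewrite /quot0 /quot1 /quot2 /discr2 /discr3; ring.
rewrite !discriminant_root // subr0 addr0 in E.
transitivity (p * ((q - p) ^+ 2 * quot h p q p)); first ring.
rewrite E mulrCA; congr (_ * _).
rewrite /D' curveB_turning // Hp subrr sub0r -/s.
have hE : h = (b * p + a) * (a * s + b) ^+ 2 / p.
  by rewrite -/(turning p) Hp mulfK // lt0r_neq0.
(* Eliminating b instead of the square root makes both sides rational in a, p and s. *)
have bE : b = s ^+ 2 - p by rewrite s2 addrC addKr.
rewrite hE; move: (s) bE => t bE; rewrite bE; field.
by rewrite lt0r_neq0.
Qed.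

End Curve.

(** * The Hamiltonian field *)

Section VectorField.
Context {R : realType}.

(* Gronwall: exp (-4Kt) (u^2 + v^2) is nonincreasing. *)
Lemma linear_flow_zero (u v A B C D : R -> R) (K : R) :
  (forall t : R, is_derive t 1 u (A t * u t + B t * v t)) ->
  (forall t : R, is_derive t 1 v (C t * u t + D t * v t)) ->
  (forall t, [/\ `|A t| <= K, `|B t| <= K, `|C t| <= K & `|D t| <= K]) ->
  u 0 = 0 -> v 0 = 0 -> forall t, 0 <= t -> u t = 0 /\ v t = 0.
Proof.
move=> du dv bnd u0 v0 t t0.
pose g (s : R) : R := expR (- (4 * K) * s) * (u s * u s + v s * v s).
pose dg (s : R) : R := expR (- (4 * K) * s) * (- (4 * K) * (u s * u s + v s * v s) +
  2 * (u s * (A s * u s + B s * v s) + v s * (C s * u s + D s * v s))).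
have hg (s : R) : is_derive s 1 g (dg s).
  have dl := is_derive_mul (is_derive_const (- (4 * K)) s) (is_derive_ident s).
  have de := is_derive_comp (g := fun r => - (4 * K) * r) (is_derive_expR _) dl.
  have dq := is_derive_add (is_derive_mul (du s) (du s)) (is_derive_mul (dv s) (dv s)).
  by apply: (is_derive_eq (is_derive_mul de dq)); rewrite /dg; ring.
have [c _ E] := mean_value t0 (fun s _ => hg s).
have g0 : g 0 = 0 by rewrite /g u0 v0 !mulr0 addr0 mulr0.
have dgc : dg c <= 0.
  rewrite /dg; apply: mulr_ge0_le0; first exact: expR_ge0.
  have [] := bnd c; rewrite !ler_norml.
  move=> /andP[a1 a2] /andP[b1 b2] /andP[c1 c2] /andP[d1 d2].
  have := sqr_ge0 (u c - v c); have := sqr_ge0 (u c + v c).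
  have := sqr_ge0 (u c); have := sqr_ge0 (v c).
  move: (u c) (v c) => x y.
  have hA : A c * x ^+ 2 <= K * x ^+ 2 by rewrite ler_wpM2r ?sqr_ge0.
  have hD : D c * y ^+ 2 <= K * y ^+ 2 by rewrite ler_wpM2r ?sqr_ge0.
  (* The two inequalities for B add up to 2 B x y <= K (x^2 + y^2), and likewise for C; together
     with the diagonal terms this gives the rate 4K. *)
  have hB : 0 <= (K - B c) * (x + y) ^+ 2 by rewrite mulr_ge0 ?sqr_ge0 // subr_ge0.
  have hB' : 0 <= (K + B c) * (x - y) ^+ 2.
    by rewrite mulr_ge0 ?sqr_ge0 // -lerBlDl sub0r.
  have hC : 0 <= (K - C c) * (x + y) ^+ 2 by rewrite mulr_ge0 ?sqr_ge0 // subr_ge0.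
  have hC' : 0 <= (K + C c) * (x - y) ^+ 2.
    by rewrite mulr_ge0 ?sqr_ge0 // -lerBlDl sub0r.
  move=> *; lra.
have gt : g t <= 0.
  by move: E; rewrite g0 !subr0 => ->; nra.
move: gt; rewrite /g pmulr_rle0 ?expR_gt0 // -!expr2 => gt.
have /eqP : u t ^+ 2 + v t ^+ 2 = 0.
  by apply/eqP; rewrite eq_le gt addr_ge0 ?sqr_ge0.
by rewrite paddr_eq0 ?sqr_ge0 // !sqrf_eq0 => /andP[/eqP -> /eqP ->].
Qed.

Variables a b h : R.
Hypotheses (ha : 0 < a) (hb : 0 < b).

(** The field (H_y, - H_x) of H = A y^2 + B y + C. *)
Definition field_x (x y : R) := 2 * curveA a b x * y + curveB a b h x.
Definition field_y (x y : R) :=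
  - (a * b ^+ 2 * y ^+ 2 + curveB' a b h x * y + a * b * (2 * b * x + b ^+ 2 + a)).

Definition integral_curve (x y : R -> R) := forall t : R,
  is_derive t 1 x (field_x (x t) (y t)) /\ is_derive t 1 y (field_y (x t) (y t)).

Lemma integral_curve_uniq_ge0 (x1 y1 x2 y2 : R -> R) (M : R) :
  integral_curve x1 y1 -> integral_curve x2 y2 ->
  (forall t, [/\ 0 <= x1 t <= M, 0 <= y1 t <= M, 0 <= x2 t <= M & 0 <= y2 t <= M]) ->
  x1 0 = x2 0 -> y1 0 = y2 0 -> forall t, 0 <= t -> x1 t = x2 t /\ y1 t = y2 t.
Proof.
move=> s1 s2 bnd x0 y0 t t0.
pose k := b * (a ^+ 2 * b + b ^+ 2) + a ^+ 3 - h.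
(* Divided differences of the polynomial field: the difference of two solutions solves a linear
   system with these coefficients, which [K] bounds on the square of side M. *)
pose A t := 2 * a * b ^+ 2 * y1 t + a ^+ 2 * b * (x1 t + x2 t) + k.
pose B t := 2 * a * b * (b * x2 t + a).
pose C t := - (2 * a ^+ 2 * b * y1 t + 2 * a * b ^+ 2).
pose D t := - (a * b ^+ 2 * (y1 t + y2 t) + 2 * a ^+ 2 * b * x2 t + k).
pose K := (4 * a * b ^+ 2 + 4 * a ^+ 2 * b) * M + 2 * a ^+ 2 * b
  + 2 * a * b ^+ 2 + `|k|.
have [|||||] := @linear_flow_zero (fun t => x1 t - x2 t) (fun t => y1 t - y2 t)
  A B C D K _ _ _ _ _ t t0.
- move=> s; have [dx1 _] := s1 s; have [dx2 _] := s2 s.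
  apply: (is_derive_eq (is_derive_sub dx1 dx2)).
  by rewrite /field_x /curveA /curveB /A /B /k; ring.
- move=> s; have [_ dy1] := s1 s; have [_ dy2] := s2 s.
  apply: (is_derive_eq (is_derive_sub dy1 dy2)).
  by rewrite /field_y /curveB' /C /D /k; ring.
- move=> s; have [/andP[? ?] /andP[? ?] /andP[? ?] /andP[? ?]] := bnd s.
  have : `|k| <= `|k| by []. rewrite {1}ler_norml => /andP[k1 k2].
  have ab2 : 0 < a * b ^+ 2 by rewrite mulr_gt0 ?exprn_gt0.
  have a2b : 0 < a ^+ 2 * b by rewrite mulr_gt0 ?exprn_gt0.
  have P0 z : 0 <= z <= M -> 0 <= a * b ^+ 2 * z <= a * b ^+ 2 * M.
    by move=> /andP[z0 zM]; rewrite mulr_ge0 ?ler_wpM2l // ltW.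
  have P1 z : 0 <= z <= M -> 0 <= a ^+ 2 * b * z <= a ^+ 2 * b * M.
    by move=> /andP[z0 zM]; rewrite mulr_ge0 ?ler_wpM2l // ltW.
  have [X1 Y1 X2 Y2] := bnd s.
  have /andP[? ?] := P0 _ X1; have /andP[? ?] := P0 _ Y1.
  have /andP[? ?] := P0 _ X2; have /andP[? ?] := P0 _ Y2.
  have /andP[? ?] := P1 _ X1; have /andP[? ?] := P1 _ Y1.
  have /andP[? ?] := P1 _ X2; have /andP[? ?] := P1 _ Y2.
  by rewrite !ler_norml /A /B /C /D /K; split; apply/andP; split; lra.
- by rewrite x0 subrr.
- by rewrite y0 subrr.
by move=> /eqP; rewrite subr_eq0 => /eqP -> /eqP; rewrite subr_eq0 => /eqP ->.
Qed.

End VectorField.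

(** * The oval as a periodic orbit of the field *)

Section OvalFlow.
Context {R : realType}.
Variables a b : R.
Hypotheses (ha : 0 < a) (hb : 0 < b).
Local Notation turning := (turning a b).

(* [p, q] is the set of abscissas of the oval of level h, and p < x_c < q; by
   [turning_gapE] the last two conditions locate p and q on either side of x_c. *)
Definition oval_range (h p q : R) :=
  [/\ 0 < p /\ p < q, turning p = h * p /\ turning q = h * q,
      forall x, p < x < q -> turning x < h * x,
      forall x, 0 < x -> turning x <= h * x -> p <= x <= q &
      p ^+ 2 < a + Num.sqrt (p + b) /\ a + Num.sqrt (q + b) < q ^+ 2].

Variables h p q : R.
Hypothesis pqh : oval_range h p q.

Let p_gt0 : 0 < p. Proof. by case: pqh => [[]]. Qed.
Let pq : p < q. Proof. by case: pqh => [[]]. Qed.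
Let q_gt0 : 0 < q := lt_trans p_gt0 pq.
Let pqn : p != q. Proof. by rewrite lt_eqF. Qed.
Let Hp : turning p = h * p. Proof. by case: pqh => _ []. Qed.
Let Hq : turning q = h * q. Proof. by case: pqh => _ []. Qed.

Lemma oval_range_gt0 x : p <= x <= q -> 0 < x.
Proof. by move=> /andP[px _]; exact: lt_le_trans p_gt0 px. Qed.

Lemma oval_range_turning x : p <= x <= q -> turning x <= h * x.
Proof.
move=> /andP[]; rewrite le_eqVlt => /predU1P[<- _|px]; first by rewrite Hp.
rewrite le_eqVlt => /predU1P[->|xq]; first by rewrite Hq.
by case: pqh => _ _ hlt _ _; rewrite ltW // hlt // px.
Qed.

Lemma curveB_lt0 x : p <= x <= q -> curveB a b h x < 0.
Proof.
move=> xpq; have x0 := oval_range_gt0 xpq; rewrite curveB_turning //.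
have : turning x - h * x <= 0 by rewrite subr_le0 oval_range_turning.
suff : 0 < 2 * a * b * (b * x + a) * Num.sqrt (x + b) by lra.
by rewrite !mulr_gt0 // ?sqrt_shift_gt0 // addr_gt0 // mulr_gt0.
Qed.

(** This keeps the density finite on the closed interval. Inside, [quot] is the positive
    discriminant divided by (x - p) (q - x); at the ends that quotient is 0 / 0, and the sign comes
    from [quot_endpoint] and the last clause of [oval_range]. *)
Lemma quot_gt0 x : p <= x <= q -> 0 < quot a b h p q x.
Proof.
have K0 y : 0 < y -> 0 < 4 * a ^+ 2 * b ^+ 2 * (b * y + a) * (a * Num.sqrt (y + b) + b).
  move=> y0; have := sqrt_shift_gt0 hb y0 => sy.
  by rewrite !mulr_gt0 // ?exprn_gt0 // addr_gt0 // mulr_gt0.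
have [_ _ hlt _ [hp hq]] := pqh.
move=> /andP[]; rewrite le_eqVlt => /predU1P[<- _|px].
  have := quot_endpoint hb p_gt0 q_gt0 pqn Hp Hq.
  rewrite /=; set K := _ * (a * _ + b) => E.
  have : 0 < p * (q - p) * quot a b h p q p.
    by rewrite E mulr_gt0 ?K0 // subr_gt0.
  by rewrite pmulr_rgt0 // mulr_gt0 // subr_gt0.
rewrite le_eqVlt => /predU1P[->|xq].
  have := quot_endpoint hb q_gt0 p_gt0 _ Hq Hp; rewrite eq_sym => /(_ pqn).
  rewrite /= quotC; set K := _ * (a * _ + b) => E.
  have : 0 < q * (q - p) * quot a b h p q q.
    have -> : q * (q - p) * quot a b h p q q = - (q * (p - q) * quot a b h p q q).
      by ring.
    by rewrite E -mulrN opprB mulr_gt0 ?K0 // subr_gt0.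
  by rewrite pmulr_rgt0 // mulr_gt0 // subr_gt0.
have x0 := lt_trans p_gt0 px.
have : 0 < discriminant a b h x.
  have hx : 0 < h * x - turning x by rewrite subr_gt0 hlt // px.
  rewrite discriminantE // mulr_gt0 // addr_gt0 // !mulr_gt0 ?sqrt_shift_gt0 //.
  by rewrite addr_gt0 // mulr_gt0.
rewrite (discriminant_factor hb x p_gt0 q_gt0 pqn Hp Hq) // pmulr_rgt0 //.
by rewrite mulr_gt0 // subr_gt0.
Qed.

Lemma oval_discriminant x : p <= x <= q ->
  discriminant a b h x = (x - p) * (q - x) * quot a b h p q x.
Proof. by move=> _; exact: discriminant_factor. Qed.

(** With s = sqrt (x + b), the equation of the curve reads A (y - s)^2 + (turning x - h x) y = 0,
    which is impossible for y > 0 when turning x > h x. *)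
Lemma oval_abscissa z : oval b a h z -> p <= z.1 <= q.
Proof.
case: z => x y [[/= x0 y0] V]; have [_ _ _ hout _] := pqh.
apply: hout => //; rewrite leNgt; apply/negP => hx.
have /(Vinv_eqE a b h x0 y0) E := V.
have A0 := curveA_gt0 ha hb x0.
have s0 := sqrt_shift_gt0 hb x0; have s2 := sqrt_shift_sqr hb x0.
have : 0 < curveA a b x * y ^+ 2 + curveB a b h x * y + curveC a b x.
  rewrite curveB_turning //.
  have -> : curveC a b x = curveA a b x * Num.sqrt (x + b) ^+ 2.
    by rewrite s2.
  have -> : 2 * a * b * (b * x + a) * Num.sqrt (x + b) =
    2 * curveA a b x * Num.sqrt (x + b) by rewrite /curveA; ring.
  move: (curveA a b x) (Num.sqrt _) A0 s0 => A s A0 s0.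
  have : 0 <= A * (y - s) ^+ 2 by rewrite mulr_ge0 ?sqr_ge0 // ltW.
  have : 0 < (turning x - h * x) * y by rewrite mulr_gt0 // subr_gt0.
  move=> *; lra.
by rewrite E ltxx.
Qed.

Lemma oval_point x r : p <= x <= q -> r ^+ 2 = discriminant a b h x ->
  oval b a h (x, (r - curveB a b h x) / (2 * curveA a b x)).
Proof.
move=> xpq rE; have x0 := oval_range_gt0 xpq.
have A0 := curveA_gt0 ha hb x0; have C0 := curveC_gt0 ha hb x0.
have B0 := curveB_lt0 xpq.
have y0 : 0 < (r - curveB a b h x) / (2 * curveA a b x).
  apply: divr_gt0; last by rewrite mulr_gt0.
  (* If r <= B < 0 then r^2 >= B^2, whereas r^2 = B^2 - 4AC with AC > 0. *)
  rewrite subr_gt0 ltNge; apply/negP => rB.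
  have AC : 0 < 4 * curveA a b x * curveC a b x.
    by apply: mulr_gt0 C0; apply: mulr_gt0 A0.
  have : curveB a b h x ^+ 2 <= r ^+ 2 by nra.
  by rewrite rE /discriminant; lra.
split=> //; apply/(Vinv_eqE a b h x0 y0).
have A1 := lt0r_neq0 A0.
transitivity ((r ^+ 2 - discriminant a b h x) / (4 * curveA a b x)).
  by rewrite /discriminant; field.
by rewrite rE subrr mul0r.
Qed.

Lemma oval_radical x y : oval b a h (x, y) ->
  field_x a b h x y ^+ 2 = discriminant a b h x.
Proof.
move=> [[/= x0 y0] /(Vinv_eqE a b h x0 y0) E].
transitivity (4 * curveA a b x *
  (curveA a b x * y ^+ 2 + curveB a b h x * y + curveC a b x) + discriminant a b h x).
  by rewrite /field_x /discriminant; ring.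
by rewrite E mulr0 add0r.
Qed.

(* [flow_radical] is the square root +-sqrt (B^2 - 4AC) = 2Ay + B. *)
Definition flow_abscissa :=
  flow_x p q (quot0 a b h p q) (quot1 a b h p q) (quot2 a b).
Definition flow_radical :=
  flow_r p q (quot0 a b h p q) (quot1 a b h p q) (quot2 a b).
Definition flow_ordinate t :=
  (flow_radical t - curveB a b h (flow_abscissa t)) /
  (2 * curveA a b (flow_abscissa t)).
Local Notation fx := flow_abscissa.
Local Notation fr := flow_radical.
Local Notation fy := flow_ordinate.

Lemma flow_abscissa_bounds t : p <= fx t <= q.
Proof. exact: flow_x_bounds. Qed.

Lemma flow_radical_sqr t : fr t ^+ 2 = discriminant a b h (fx t).
Proof.
by rewrite oval_discriminant ?flow_abscissa_bounds // flow_r_sqr //; exact: quot_gt0.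
Qed.

Lemma flow_oval t : oval b a h (fx t, fy t).
Proof. by apply: oval_point; [exact: flow_abscissa_bounds|exact: flow_radical_sqr]. Qed.

Lemma flow_radicalE t : fr t = field_x a b h (fx t) (fy t).
Proof.
have A0 := curveA_gt0 ha hb (oval_range_gt0 (flow_abscissa_bounds t)).
by rewrite /field_x /fy; field; exact: lt0r_neq0.
Qed.

Lemma is_derive_flow_abscissa (t : R) : is_derive t 1 fx (fr t).
Proof. by apply: is_derive_flow_x => //; exact: quot_gt0. Qed.

Lemma is_derive_curveA (x : R) : is_derive x 1 (curveA a b) (a * b * b).
Proof.
have dx := is_derive_mul (is_derive_const b x) (is_derive_ident x).
have dl := is_derive_add dx (is_derive_const a x).
apply: (is_derive_eq (is_derive_mul (is_derive_const (a * b) x) dl)).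
by ring.
Qed.

Lemma is_derive_curveB (x : R) :
  is_derive x 1 (curveB a b h) (curveB' a b h x).
Proof.
have dx := is_derive_ident x.
have d1 := is_derive_add (is_derive_mul (is_derive_const b x) dx) (is_derive_const a x).
have d2 := is_derive_add (is_derive_add (is_derive_mul (is_derive_const (a ^+ 2) x) dx)
  (is_derive_const (a ^+ 2 * b) x)) (is_derive_const (b ^+ 2) x).
have d3 := is_derive_sub (is_derive_mul d1 d2) (is_derive_mul (is_derive_const h x) dx).
by apply: (is_derive_eq d3); rewrite /curveB'; ring.
Qed.

(** The second equation comes from differentiating y = (r - B) / (2A), where r' is half the
    x-derivative of B^2 - 4AC. Nothing is divided by r, so the turning points need no separate
    case. *)
Lemma flow_integral_curve : integral_curve a b h fx fy.
Proof.
move=> t; have dx := is_derive_flow_abscissa t.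
split; first by rewrite -flow_radicalE.
have xpq := flow_abscissa_bounds t.
have x0 := oval_range_gt0 xpq.
have A0 := curveA_gt0 ha hb x0.
have dr : is_derive t 1 fr
    ((midpoint p q - fx t) * quot a b h p q (fx t) + (fx t - p) * (q - fx t) *
     (quot1 a b h p q + 2 * quot2 a b * fx t) / 2).
  exact: (is_derive_flow_r pq quot_gt0 t).
have dB := is_derive_comp (is_derive_curveB _) dx.
have dA := is_derive_mul (is_derive_const 2 t) (is_derive_comp (is_derive_curveA _) dx).
have A1 : 2 * curveA a b (fx t) != 0 by rewrite lt0r_neq0 // mulr_gt0.
have dV := is_derive_inv (f := fun s => 2 * curveA a b (fx s)) A1 dA.
apply: (is_derive_eq (is_derive_mul (is_derive_sub dr dB) dV)).
set r' := _ + _ / 2.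
have r'E : r' = curveB a b h (fx t) * curveB' a b h (fx t)
    - 2 * (a * b * b * curveC a b (fx t)
           + curveA a b (fx t) * (a * b * (2 * b * fx t + b ^+ 2 + a))).
  apply: (@mulfI _ (2 * (q - p))); first by rewrite mulf_neq0 // subr_eq0 eq_sym.
  have := discriminant_interpolation_derive a b h p q (fx t).
  rewrite !(discriminant_root hb) // subr0 add0r => E.
  transitivity ((q - p) * ((p + q - 2 * fx t) * quot a b h p q (fx t) +
   (fx t - p) * (q - fx t) * (quot1 a b h p q + 2 * quot2 a b * fx t))).
    by rewrite /r' /midpoint; field.
  by rewrite -E; ring.
have [_ /(Vinv_eqE a b h x0)] := flow_oval t.
have [[_ y0] _] := flow_oval t => /(_ y0) Eq.
(* Replacing C by means of the curve equation leaves a rational identity in A, B, y and their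
   derivatives. *)
have CE : curveC a b (fx t) =
    - (curveA a b (fx t) * fy t ^+ 2 + curveB a b h (fx t) * fy t) by lra.
have A2 := lt0r_neq0 A0.
have rE : fr t = 2 * curveA a b (fx t) * fy t + curveB a b h (fx t).
  exact: flow_radicalE.
rewrite r'E CE rE /field_y.
by field.
Qed.

End OvalFlow.

(** * Invariance of the field under the map *)

Section FmapSymmetry.
Context {R : realType}.
Variables a b h : R.
Hypotheses (ha : 0 < a) (hb : 0 < b).

(** The field depends on h, and the map carries it to itself only on the level h. Once h is replaced
    by V(x, y), both equations are identities between rational functions of x and y. *)
Lemma Fmap_integral_curve (x y : R -> R) : integral_curve a b h x y ->
  (forall t, oval b a h (x t, y t)) ->
  integral_curve a b h (fun t => (Fmap b a (x t, y t)).1)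
    (fun t => (Fmap b a (x t, y t)).2).
Proof.
move=> sol ov t; have [dx dy] := sol t.
have [[/= x0 y0] V] := ov t.
have x1 := lt0r_neq0 x0; have y1 := lt0r_neq0 y0.
have xy1 : x t * y t != 0 by rewrite mulf_neq0.
have axy : a + b * x t + y t != 0.
  by rewrite lt0r_neq0 // !addr_gt0 // mulr_gt0.
have ay : a + y t != 0 by rewrite lt0r_neq0 // addr_gt0.
have da := is_derive_const a t.
have dX := is_derive_mul (is_derive_add da dy) (is_derive_inv (f := x) x1 dx).
have dbx := is_derive_mul (is_derive_const b t) dx.
have dY := is_derive_mul (is_derive_add (is_derive_add da dbx) dy)
  (is_derive_inv (f := fun s => x s * y s) xy1 (is_derive_mul dx dy)).
rewrite /field_x /field_y /curveB /curveB' /curveA -V /Vinv /= in dX dY *.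
split.
  apply: (is_derive_eq dX); rewrite {dX dY dbx dx dy sol ov V}.
  move: (x t) (y t) x1 y1 xy1 axy ay => u v u1 v1 uv1 auv av.
  by field; rewrite u1 v1.
apply: (is_derive_eq dY); rewrite {dX dY dbx dx dy sol ov V}.
move: (x t) (y t) x1 y1 xy1 axy ay => u v u1 v1 uv1 auv av.
by field; rewrite ?u1 ?v1 ?av ?auv.
Qed.

(** The expansion of V contains the terms a^2 b x and a b^2 y, and all its other terms are
    positive. *)
Lemma oval_bounded (x y : R) : oval b a h (x, y) ->
  0 <= x <= h / (a ^+ 2 * b) /\ 0 <= y <= h / (a * b ^+ 2).
Proof.
move=> [[/= x0 y0] <-]; rewrite /Vinv /=.
have x1 := lt0r_neq0 x0; have y1 := lt0r_neq0 y0.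
have a1 := lt0r_neq0 ha; have b1 := lt0r_neq0 hb.
have P : 0 < (x * y)^-1 by rewrite invr_gt0 mulr_gt0.
split; rewrite ltW //=.
  rewrite -subr_ge0.
  have -> : (b * x + a) * (a * y + b) * (a * x + b * y + a * b) / (x * y) /
    (a ^+ 2 * b) - x = ((b * x + a) * (a * y + b) * (b * y + a * b)
     + a * x * ((b * x + a) * b + a * a * y)) / (x * y * (a ^+ 2 * b)).
    by field; rewrite x1 y1 a1 b1.
  by rewrite ltW // divr_gt0 // ?addr_gt0 ?mulr_gt0 ?exprn_gt0 //
    ?addr_gt0 ?mulr_gt0 // ?addr_gt0 ?mulr_gt0.
rewrite -subr_ge0.
have -> : (b * x + a) * (a * y + b) * (a * x + b * y + a * b) / (x * y) /
  (a * b ^+ 2) - y = ((b * x + a) * (a * y + b) * (a * x + a * b)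
   + b * y * ((b * x + a) * b + a * a * y)) / (x * y * (a * b ^+ 2)).
  by field; rewrite x1 y1 a1 b1.
by rewrite ltW // divr_gt0 // ?addr_gt0 ?mulr_gt0 ?exprn_gt0 //
    ?addr_gt0 ?mulr_gt0 // ?addr_gt0 ?mulr_gt0.
Qed.

Lemma integral_curve_uniq (x1 y1 x2 y2 : R -> R) :
  integral_curve a b h x1 y1 -> integral_curve a b h x2 y2 ->
  (forall t, oval b a h (x1 t, y1 t)) -> (forall t, oval b a h (x2 t, y2 t)) ->
  x1 0 = x2 0 -> y1 0 = y2 0 -> forall t, 0 <= t -> x1 t = x2 t /\ y1 t = y2 t.
Proof.
move=> s1 s2 o1 o2.
apply: (integral_curve_uniq_ge0 ha hb
  (M := Num.max (h / (a ^+ 2 * b)) (h / (a * b ^+ 2))) s1 s2).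
move=> t; have [/andP[? ?] /andP[? ?]] := oval_bounded (o1 t).
have [/andP[? ?] /andP[? ?]] := oval_bounded (o2 t).
by split; apply/andP; split => //; rewrite le_max; apply/orP; (by left) || (by right).
Qed.

End FmapSymmetry.

Lemma continuous_within_comp {S T U : topologicalType} (A : set S) (B : set T)
    (f : S -> T) (g : T -> U) :
  set_fun A B f -> (forall x, A x -> {for x, continuous f}) ->
  {within B, continuous g} -> {within A, continuous (g \o f)}.
Proof.
move=> fAB cf /subspace_continuousP cg; apply/subspace_continuousP => x Ax.
have gx := cg _ (fAB x Ax).
suff : f y @[y --> within A (nbhs x)] --> within B (nbhs (f x)).
  by move=> fx; apply: cvg_trans gx => V; exact: fx.
move=> V; rewrite /within /= => fV.
have : \forall y \near x, B (f y) -> V (f y) by exact: cf fV.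
by rewrite /nbhs /= => H; apply: filterS H => y H Ay; apply: H; exact: fAB.
Qed.

Lemma continuous_pair {S T U : topologicalType} (f : S -> T) (g : S -> U) x :
  {for x, continuous f} -> {for x, continuous g} ->
  {for x, continuous (fun y => (f y, g y))}.
Proof. by move=> cf cg; exact: cvg_pair cf cg. Qed.

(** * Conjugacy to a rotation *)

Section Conjugacy.
Context {R : realType}.
Variables a b h p q : R.
Hypotheses (ha : 0 < a) (hb : 0 < b) (pqh : oval_range a b h p q).

Definition oval_density :=
  clock_density p q (quot0 a b h p q) (quot1 a b h p q) (quot2 a b).
Definition oval_time := primitive oval_density.
Definition oval_period := oval_time (2 * pi).
(* The leftmost point of the oval is (p, sqrt (p + b)); this is the abscissa of
   its image by F, and [rotation_cosine] the cosine of the corresponding angle. *)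
Definition first_image := (a + Num.sqrt (p + b)) / p.
Definition rotation_cosine := (p + q - 2 * first_image) / (q - p).
Definition rotation_time := oval_time (acos rotation_cosine).

Local Notation w := oval_density.
Local Notation W := oval_time.
Local Notation T := oval_period.
Local Notation fx := (flow_abscissa a b h p q).
Local Notation fr := (flow_radical a b h p q).
Local Notation fy := (flow_ordinate a b h p q).
Local Notation phi :=
  (angle_at_time p q (quot0 a b h p q) (quot1 a b h p q) (quot2 a b)).
Local Notation m := (midpoint p q).
Local Notation d := (halfwidth p q).
Local Notation t1 := rotation_time.
Local Notation X1 := first_image.

Let p_gt0 : 0 < p. Proof. by case: pqh => [[]]. Qed.
Let pq : p < q. Proof. by case: pqh => [[]]. Qed.
Let E_gt0 := quot_gt0 ha hb pqh.
Let sp_gt0 := sqrt_shift_gt0 hb p_gt0.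
Let sp_sqr := sqrt_shift_sqr hb p_gt0.
Let d_gt0 : 0 < d. Proof. by rewrite divr_gt0 // subr_gt0. Qed.
Let d_neq0 : d != 0 := lt0r_neq0 d_gt0.
Let phi_spec := angle_at_time_spec pq E_gt0.
Let cw : continuous w := clock_density_continuous pq E_gt0.
Let T_gt0 : 0 < T := clock_period_gt0 pq E_gt0.

Lemma flow_start : [/\ fx 0 = p, fr 0 = 0 & fy 0 = Num.sqrt (p + b)].
Proof.
have x0 : fx 0 = p := flow_x_start pq E_gt0.
have r0 : fr 0 = 0.
  have := flow_radical_sqr ha hb pqh 0; rewrite x0 discriminant_root //.
    by move/eqP; rewrite sqrf_eq0 => /eqP.
  by case: pqh => _ [].
split=> //; rewrite /flow_ordinate r0 x0 curveB_turning //.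
have -> : turning a b p = h * p by case: pqh => _ [].
have A0 : b * p + a != 0 by rewrite lt0r_neq0 // addr_gt0 // mulr_gt0.
by rewrite /curveA; field; rewrite A0 !lt0r_neq0.
Qed.

Definition second_image := (b + X1) / Num.sqrt (p + b).
Local Notation Y1 := second_image.

Lemma Fmap_start : Fmap b a (p, Num.sqrt (p + b)) = (X1, Y1).
Proof.
rewrite /Fmap /Y1 /X1 /=; congr (_, _).
by field; rewrite !lt0r_neq0.
Qed.

Lemma first_image_oval : oval b a h (X1, Y1).
Proof.
rewrite -Fmap_start; apply: Fmap_oval => //.
have [x0 _ y0] := flow_start.
by have := flow_oval ha hb pqh 0; rewrite x0 y0.
Qed.

Lemma first_image_bounds : p < X1 <= q.
Proof.
have /andP[_ /= ->] := oval_abscissa ha hb pqh first_image_oval.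
rewrite andbT ltr_pdivlMr // -expr2.
by case: pqh => _ _ _ _ [].
Qed.

(** The horizontal switch sends (p, s), s = sqrt (p + b), to (X1, s), and the vertical one sends
    that to (X1, Y1) with s Y1 = X1 + b. The roots over X1 are thus s and Y1, so 2AY1 + B = A (Y1 -
    s), and X1 > p gives Y1 > s. Hence the image is on the half where x increases, and its angle is
    an arccosine. *)
Lemma first_image_upper : 0 < field_x a b h X1 Y1.
Proof.
have /andP[pX _] := first_image_bounds.
have [[/= X0 Y0] /(Vinv_eqE a b h X0 Y0) E] := first_image_oval.
have A0 := curveA_gt0 ha hb X0.
have YE : Y1 * Num.sqrt (p + b) = X1 + b.
  by rewrite /Y1 divfK ?lt0r_neq0 // addrC.
have C : curveC a b X1 = curveA a b X1 * (Y1 * Num.sqrt (p + b)).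
  by rewrite YE.
have -> : field_x a b h X1 Y1 = curveA a b X1 * (Y1 - Num.sqrt (p + b)).
  apply: (mulIf (lt0r_neq0 Y0)); rewrite /field_x; rewrite C in E; lra.
rewrite mulr_gt0 // subr_gt0 -(ltr_pM2r sp_gt0) YE -expr2 sp_sqr.
by rewrite ltrD2r.
Qed.

Lemma first_image_lt : X1 < q.
Proof.
have /andP[_ Xq] := first_image_bounds.
rewrite lt_neqAle Xq andbT; apply/eqP => XE.
have := oval_radical first_image_oval; rewrite XE discriminant_root //.
- move/eqP; rewrite sqrf_eq0 -XE => /eqP E.
  by have := first_image_upper; rewrite E ltxx.
- exact: lt_trans pq.
- by case: pqh => _ [].
Qed.

Lemma rotation_cosine_bounds : -1 < rotation_cosine < 1.
Proof.
have /andP[pX _] := first_image_bounds; have Xq := first_image_lt.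
have qp : 0 < q - p by rewrite subr_gt0.
rewrite /rotation_cosine ltr_pdivlMr // ltr_pdivrMr //.
by apply/andP; split; lra.
Qed.

Let c1_bounds : -1 <= rotation_cosine <= 1.
Proof. by have /andP[/ltW -> /ltW ->] := rotation_cosine_bounds. Qed.

Lemma flow_rotation_time : fx t1 = X1 /\ fy t1 = Y1.
Proof.
have [f1 _ _] := phi_spec.
have phi1 : phi t1 = acos rotation_cosine by exact: f1.
have qp : q - p != 0 by rewrite lt0r_neq0 // subr_gt0.
have xE : fx t1 = X1.
  rewrite /flow_abscissa /flow_x phi1 /abscissa acosK ?in_itv //.
  by rewrite /rotation_cosine /midpoint /halfwidth; field.
have r_ge0 : 0 <= fr t1.
  rewrite /flow_radical /flow_r phi1; apply: mulr_ge0; last exact: sqrtr_ge0.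
  apply: mulr_ge0; first exact: ltW.
  by apply: sin_ge0_pi; rewrite acos_ge0 // acos_lepi.
have rE : fr t1 = field_x a b h X1 Y1.
  apply/eqP; rewrite -(@eqrXn2 _ 2) //; last exact/ltW/first_image_upper.
  rewrite (flow_radical_sqr ha hb pqh) xE.
  by rewrite (oval_radical first_image_oval).
split=> //; rewrite /flow_ordinate rE xE /field_x addrK mulrAC divff ?mul1r //.
have [[/= X0 _] _] := first_image_oval.
have := curveA_gt0 ha hb X0 => A0.
by rewrite lt0r_neq0 // mulr_gt0.
Qed.

Lemma flow_periodic t : (fx (t + T), fy (t + T)) = (fx t, fy t).
Proof.
have ex : fx (t + T) = fx t := flow_x_periodic pq E_gt0 t.
have er : fr (t + T) = fr t := flow_r_periodic pq E_gt0 t.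
by rewrite /flow_ordinate er ex.
Qed.

Lemma Fmap_flow t : Fmap b a (fx t, fy t) = (fx (t + t1), fy (t + t1)).
Proof.
(* Uniqueness is available forward in time only; adding periods brings t into that range. *)
wlog t0 : t / 0 <= t.
  move=> H; pose n := Num.bound (t / T).
  have tn : 0 <= t + T *+ n.
    have : `|t| < T *+ n.
      rewrite -mulr_natr mulrC -ltr_pdivrMr //.
      have := archi_boundP (normr_ge0 (t / T)).
      by rewrite /n /Num.bound normr_id normrM normfV (gtr0_norm T_gt0).
    by rewrite ltr_norml => /andP[/ltW]; lra.
  have per s : (fx (s + T *+ n), fy (s + T *+ n)) = (fx s, fy s).
    elim: n {tn} => [|n IH]; first by rewrite mulr0n addr0.
    by rewrite mulrSr addrA flow_periodic.
  by rewrite -(per t) (H _ tn) addrAC per.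
have o1 s : oval b a h (fx s, fy s) by exact: flow_oval.
have c1 : integral_curve a b h fx fy by exact: flow_integral_curve.
have [||||||E1 E2] := @integral_curve_uniq _ a b h ha hb
  (fun s => (Fmap b a (fx s, fy s)).1) (fun s => (Fmap b a (fx s, fy s)).2)
  (fun s => fx (s + t1)) (fun s => fy (s + t1)) _ _ _ _ _ _ t t0.
- exact: Fmap_integral_curve.
- move=> s; have [dx dy] := c1 (s + t1).
  have ds := is_derive_add (is_derive_ident s) (is_derive_const t1 s).
  split.
    apply: (is_derive_eq (is_derive_comp (g := fun r => r + t1) dx ds)).
    by rewrite addr0 mulr1.
  apply: (is_derive_eq (is_derive_comp (g := fun r => r + t1) dy ds)).
  by rewrite addr0 mulr1.
- by move=> s; rewrite -surjective_pairing; apply: Fmap_oval.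
- by move=> s; exact: o1.
- have [-> _ ->] := flow_start; rewrite Fmap_start add0r /=.
  by case: flow_rotation_time.
- have [-> _ ->] := flow_start; rewrite Fmap_start add0r /=.
  by case: flow_rotation_time.
by rewrite -E1 -E2 -surjective_pairing.
Qed.


Definition rotation_number := t1 / T.

Lemma rotation_number_bounds : 0 <= rotation_number <= 2^-1.
Proof.
have W0 : W 0 = 0 := primitive_clock0 pq E_gt0.
have Wpi : W pi = T / 2 := clock_half pq E_gt0.
have lW : {mono W : x y / x <= y}.
  exact: (primitive_le cw (clock_density_gt0 pq E_gt0)).
have t1_ge0 : 0 <= t1 by rewrite -W0 /rotation_time lW acos_ge0.
rewrite /rotation_number divr_ge0 ?(ltW T_gt0) //=.
by rewrite ler_pdivrMr // mulrC -Wpi /rotation_time lW acos_lepi.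
Qed.

Local Notation omega := (2 * pi / T).
Let tpi_gt0 : 0 < 2 * pi :> R. Proof. by rewrite mulr_gt0 ?pi_gt0. Qed.
Let T_neq0 : T != 0 := lt0r_neq0 T_gt0.
Let omega_neq0 : omega != 0 := lt0r_neq0 (divr_gt0 tpi_gt0 T_gt0).

(** The pair (cos phi, sin phi) written in the coordinates of the point, without reference to the
    flow, so that continuity can be read off the formula. *)
Definition oval_to_circle (z : R * R) : R * R :=
  ((m - z.1) / d,
   field_x a b h z.1 z.2 / (d * Num.sqrt (quot a b h p q z.1))).

Lemma oval_to_circle_circle z : oval b a h z -> circle (oval_to_circle z).
Proof.
move=> oz; have zpq := oval_abscissa ha hb pqh oz.
have E0 := E_gt0 zpq; have E1 := lt0r_neq0 E0.
rewrite /circle /= !expr_div_n exprMn.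
have -> : field_x a b h z.1 z.2 ^+ 2 = (z.1 - p) * (q - z.1) * quot a b h p q z.1.
  rewrite -(oval_discriminant hb pqh zpq); apply: oval_radical.
  by rewrite -surjective_pairing.
rewrite sqr_sqrtr ?(ltW E0) //.
have qp : q - p != 0 by rewrite lt0r_neq0 // subr_gt0.
by rewrite /midpoint /halfwidth; field; rewrite E1.
Qed.

Lemma oval_to_circle_flow t :
  oval_to_circle (fx t, fy t) = (cos (phi t), sin (phi t)).
Proof.
have E0 := E_gt0 (flow_abscissa_bounds pqh t).
rewrite /oval_to_circle /= -flow_radicalE //; congr (_, _).
  by rewrite /flow_abscissa /flow_x /abscissa opprB addrC subrK mulrC mulKf.
rewrite /flow_radical /flow_r -/(flow_x _ _ _ _ _ _) -/(fx t).
rewrite -/(quot a b h p q (fx t)).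
have S0 : Num.sqrt (quot a b h p q (fx t)) != 0 by rewrite lt0r_neq0 // sqrtr_gt0.
by field; rewrite S0 d_neq0.
Qed.

Lemma flow_surj z : oval b a h z -> exists t, z = (fx t, fy t).
Proof.
move=> oz; have [f1 f2 _] := phi_spec.
have zpq := oval_abscissa ha hb pqh oz.
have E0 := E_gt0 zpq.
pose u := circle_arg (oval_to_circle z).
exists (W u).
have /circle_argK := oval_to_circle_circle oz; rewrite -/u => E.
have cE := congr1 fst E; have sE := congr1 snd E.
rewrite /= in cE sE.
have pu : phi (W u) = u by exact: f1.
have xE : fx (W u) = z.1.
  rewrite /flow_abscissa /flow_x pu /abscissa cE mulrC divfK //.
  by rewrite opprB addrC subrK.
have S0 : 0 < Num.sqrt (quot a b h p q z.1) by rewrite sqrtr_gt0.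
have rE : fr (W u) = field_x a b h z.1 z.2.
  rewrite /flow_radical /flow_r -/(flow_x _ _ _ _ _ _) -/(fx _) xE pu sE.
  rewrite -/(quot a b h p q z.1); field.
  by rewrite d_neq0 lt0r_neq0.
have [[z10 _] _] := oz.
have A0 := curveA_gt0 ha hb z10.
rewrite [LHS]surjective_pairing /flow_ordinate rE xE; congr (_, _).
by rewrite /field_x; field; rewrite lt0r_neq0.
Qed.

(** Passes from the regularizing angle to the angle proportional to time, in which the map becomes a
    rotation. *)
Definition circle_coordinate (u : R) : R * R :=
  (cos (omega * W u), sin (omega * W u)).
Definition flow_coordinate (u : R) : R * R := (fx (u / omega), fy (u / omega)).

Let circle_coordinate_per u : circle_coordinate (u + 2 * pi) = circle_coordinate u.
Proof.
have Wu : W (u + 2 * pi) = W u + T.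
  exact: (primitive_shift cw (clock_density_periodic _ _ _ _ _)).
rewrite /circle_coordinate Wu mulrDr.
by rewrite divfK // cosD2piE sinD2piE.
Qed.

Let flow_coordinate_per u : flow_coordinate (u + 2 * pi) = flow_coordinate u.
Proof.
rewrite /flow_coordinate mulrDl.
have -> : 2 * pi / omega = T.
  by rewrite invf_div mulrC divfK // lt0r_neq0.
exact: flow_periodic.
Qed.

Let dW (u : R) : is_derive u 1 W (w u).
Proof. by case: (primitive_spec cw) => _; exact. Qed.

Lemma continuous_oval_to_circle z : oval b a h z ->
  {for z, continuous oval_to_circle}.
Proof.
move=> oz; have zpq := oval_abscissa ha hb pqh oz.
have E0 := E_gt0 zpq.
have cB : {for z.1, continuous (curveB a b h)}.
  exact: is_derive_continuous (is_derive_curveB _ _ _ _).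
have cA : {for z.1, continuous (curveA a b)}.
  exact: is_derive_continuous (is_derive_curveA _ _ _).
have cE : {for z.1, continuous (quot a b h p q)}.
  exact: is_derive_continuous (is_derive_quadratic _ _ _ _).
have c1 : {for z, continuous (fst : R * R -> R)} by exact: cvg_fst.
have c2 : {for z, continuous (snd : R * R -> R)} by exact: cvg_snd.
apply: (@continuous_pair _ _ _ (fun s => (oval_to_circle s).1)
    (fun s => (oval_to_circle s).2)) => /=.
  by apply: cvgM; [apply: cvgB; [exact: cvg_cst|exact: c1]|exact: cvg_cst].
apply: cvgM.
  apply: cvgD; last exact: continuous_comp c1 cB.
  by apply: cvgM c2; apply: cvgM; [exact: cvg_cst|exact: continuous_comp c1 cA].
apply: cvgV; first by rewrite mulf_neq0 // lt0r_neq0 // sqrtr_gt0.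
apply: cvgM; first exact: cvg_cst.
apply: continuous_comp; first exact: continuous_comp c1 cE.
exact: sqrt_continuous.
Qed.

Lemma oval_has_rotation_number :
  has_rotation_number (oval b a h) (Fmap b a) rotation_number.
Proof.
have [f1 f2 _] := phi_spec.
have cC : continuous circle_coordinate.
  move=> u; have cWu : {for u, continuous (fun s => omega * W s)}.
    apply: cvgM; first exact: cvg_cst.
    exact: is_derive_continuous (dW u).
  apply: (@continuous_pair _ _ _ (fun s : R => (circle_coordinate s).1)
    (fun s : R => (circle_coordinate s).2)) => /=.
    apply: (@continuous_comp _ _ _ (fun s => omega * W s) cos) => //.
    exact: continuous_cos.
  apply: (@continuous_comp _ _ _ (fun s => omega * W s) sin) => //.
  exact: continuous_sin.
have cF : continuous flow_coordinate.
  move=> u; have cu : {for u, continuous (fun s : R => s / omega)}.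
    by apply: cvgM; [exact: cvg_id|exact: cvg_cst].
  have [dx dy] := flow_integral_curve ha hb pqh (u / omega).
  apply: (@continuous_pair _ _ _ (fun s : R => (flow_coordinate s).1)
    (fun s : R => (flow_coordinate s).2)) => /=.
    apply: (@continuous_comp _ _ _ (fun s : R => s / omega) fx) => //.
    exact: is_derive_continuous dx.
  apply: (@continuous_comp _ _ _ (fun s : R => s / omega) fy) => //.
  exact: is_derive_continuous dy.
have fE t : circle_coordinate (circle_arg (oval_to_circle (fx t, fy t))) =
    (cos (omega * t), sin (omega * t)).
  rewrite oval_to_circle_flow (circle_argE circle_coordinate_per).
  have WW : W (phi t) = t by exact: f2.
  by rewrite /circle_coordinate WW.
split; first exact: rotation_number_bounds.
split.
- by move=> z; exact: Fmap_oval.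
- move=> z; rewrite /circle /rotation /= => zc.
  transitivity ((cos (2 * pi * rotation_number) ^+ 2 +
    sin (2 * pi * rotation_number) ^+ 2) * (z.1 ^+ 2 + z.2 ^+ 2)); first ring.
  by rewrite cos2Dsin2 mul1r.
exists ((circle_coordinate \o circle_arg) \o oval_to_circle).
exists (flow_coordinate \o circle_arg); split.
  split.
  - by move=> z oz /=; rewrite /circle /= cos2Dsin2.
  - by move=> z _; exact: flow_oval.
  - move=> z /flow_surj[t ->]; rewrite /= fE (circle_argE flow_coordinate_per).
    by rewrite /flow_coordinate mulrC mulKf.
  - move=> z zc; rewrite /= /flow_coordinate fE.
    by rewrite mulrC divfK // circle_argK.
  split.
    apply: continuous_within_comp (circle_map_continuous circle_coordinate_per cC).
      exact: oval_to_circle_circle.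
    exact: continuous_oval_to_circle.
  exact: circle_map_continuous.
move=> z /flow_surj[t ->]; rewrite Fmap_flow /= !fE /rotation /=.
have -> : 2 * pi * rotation_number = omega * t1.
  by rewrite /rotation_number mulrA mulrAC.
by rewrite mulrDr cosD sinD; congr (_, _); ring.
Qed.

End Conjugacy.

(** The intermediate point must be interior for the strict monotonicity of the level, whose
    derivative vanishes at x_c, a possible end of the interval. *)
Lemma mean_value_open {R : realType} (f df : R -> R) (a b : R) : a < b ->
  (forall x, a <= x <= b -> is_derive x 1 f (df x)) ->
  exists2 c, a < c < b & f b - f a = df c * (b - a).
Proof.
move=> ab hf.
have [| |c cab E] := @MVT R f df a b ab.
- by move=> x; rewrite in_itv /= => /andP[/ltW ax /ltW xb]; apply: hf; rewrite ax.
- apply: continuous_in_subspaceT => x; rewrite inE /= in_itv /= => xab.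
  exact: is_derive_continuous (hf x xab).
- by exists c => //; move: cab; rewrite in_itv.
Qed.

(** * The level as a function of the leftmost abscissa *)

Section Level.
Context {R : realType}.
Variables a b xc yc : R.
Hypotheses (ha : 0 < a) (hb : 0 < b) (xc_gt0 : 0 < xc) (yc_gt0 : 0 < yc)
  (xc_sqr : xc ^+ 2 = a + yc) (yc_sqr : yc ^+ 2 = b + xc).

Lemma fixed_sqrt : Num.sqrt (xc + b) = yc.
Proof. by rewrite addrC -yc_sqr sqrtr_sqr gtr0_norm. Qed.

(** (xc yc)^2 = (a + yc) (b + xc) exceeds xc yc. *)
Lemma fixed_prod_gt1 : 1 < xc * yc.
Proof.
have xy0 : 0 < xc * yc by rewrite mulr_gt0.
rewrite -(ltr_pM2r xy0) mul1r -expr2 exprMn xc_sqr yc_sqr.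
have := mulr_gt0 ha hb; have := mulr_gt0 ha xc_gt0; have := mulr_gt0 hb yc_gt0.
by move=> *; lra.
Qed.

(** The divided difference between x and xc of x^2 - a - sqrt (x + b), a function that vanishes at
    xc. *)
Definition turning_gap (x : R) := x + xc - (Num.sqrt (x + b) + yc)^-1.

Lemma turning_gapE x : 0 < x ->
  x ^+ 2 - a - Num.sqrt (x + b) = (x - xc) * turning_gap x.
Proof.
move=> x0; have s0 := sqrt_shift_gt0 hb x0; have s2 := sqrt_shift_sqr hb x0.
rewrite /turning_gap; move: (Num.sqrt _) s0 s2 => s s0 s2.
have n0 : s + yc != 0 by rewrite lt0r_neq0 // addr_gt0.
have -> : a = xc ^+ 2 - yc by rewrite xc_sqr addrK.
have dE : x - xc = (s - yc) * (s + yc).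
  by rewrite -subr_sqr s2 yc_sqr; ring.
rewrite mulrBr {2}dE mulfK //; ring.
Qed.

(** 1 / (sqrt (x + b) + yc) < 1 / yc < xc, the last step by [fixed_prod_gt1]. *)
Lemma turning_gap_gt0 x : 0 < x -> 0 < turning_gap x.
Proof.
move=> x0; have s0 := sqrt_shift_gt0 hb x0.
rewrite subr_gt0 (@lt_trans _ _ xc) ?ltrDr //.
rewrite (@lt_trans _ _ yc^-1) //.
  by rewrite ltf_pV2 ?posrE ?addr_gt0 // ltrDr.
by rewrite -div1r ltr_pdivrMr // fixed_prod_gt1.
Qed.

(** The level at which x is a turning abscissa. *)
Definition level (x : R) := turning a b x / x.

Lemma level_mul x : 0 < x -> turning a b x = level x * x.
Proof. by move=> x0; rewrite /level divfK // lt0r_neq0. Qed.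

Definition level' (x : R) :=
  a * b * (a * Num.sqrt (x + b) + b) / (x ^+ 2 * Num.sqrt (x + b)) *
  ((x - xc) * turning_gap x).

Lemma is_derive_level (x : R) : 0 < x -> is_derive x 1 level (level' x).
Proof.
move=> x0; have s0 := sqrt_shift_gt0 hb x0; have s2 := sqrt_shift_sqr hb x0.
have x1 := lt0r_neq0 x0; have s1 := lt0r_neq0 s0.
have dx := is_derive_ident x.
have dxb := is_derive_add dx (is_derive_const b x).
have xb0 : 0 < x + b by rewrite addr_gt0.
have ds := is_derive_comp (g := fun t => t + b) (is_derive1_sqrt xb0) dxb.
have dl := is_derive_add (is_derive_mul (is_derive_const a x) ds) (is_derive_const b x).
have dn := is_derive_add (is_derive_mul (is_derive_const b x) dx) (is_derive_const a x).
have dt := is_derive_mul dn (is_derive_mul dl dl).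
apply: (is_derive_eq (is_derive_mul dt (is_derive_inv (f := fun t => t) x1 dx))).
rewrite /level' -turning_gapE //.
move: (Num.sqrt _) s0 s2 s1 {ds dl dt} => s s0 s2 s1.
have -> : b = s ^+ 2 - x by rewrite s2 addrC addKr.
by field; rewrite x1 s1.
Qed.

Lemma level'_sgn x : 0 < x -> exists2 k, 0 < k & level' x = k * (x - xc).
Proof.
move=> x0; have s0 := sqrt_shift_gt0 hb x0.
exists (a * b * (a * Num.sqrt (x + b) + b) / (x ^+ 2 * Num.sqrt (x + b)) * turning_gap x).
  rewrite mulr_gt0 ?turning_gap_gt0 // divr_gt0 // ?mulr_gt0 ?exprn_gt0 //.
  by rewrite addr_gt0 ?mulr_gt0.
by rewrite /level'; ring.
Qed.

Lemma level_decr x y : 0 < x -> x < y -> y <= xc -> level y < level x.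
Proof.
move=> x0 xy yxc.
have [|c /andP[xc' cy] E] := @mean_value_open _ level level' x y xy.
  by move=> z /andP[xz _]; apply: is_derive_level; exact: lt_le_trans xz.
have [k k0 kE] := level'_sgn (lt_trans x0 xc').
rewrite -subr_lt0 E kE -mulrA pmulr_rlt0 // nmulr_rlt0 ?subr_gt0 //.
by rewrite subr_lt0 (lt_le_trans cy).
Qed.

Lemma level_incr x y : xc <= x -> x < y -> level x < level y.
Proof.
move=> xcx xy; have x0 := lt_le_trans xc_gt0 xcx.
have [|c /andP[xc' cy] E] := @mean_value_open _ level level' x y xy.
  by move=> z /andP[xz _]; apply: is_derive_level; exact: lt_le_trans xz.
have [k k0 kE] := level'_sgn (lt_trans x0 xc').
rewrite -subr_gt0 E kE -mulrA pmulr_rgt0 // pmulr_rgt0 ?subr_gt0 //.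
exact: le_lt_trans xc'.
Qed.

Lemma level_decrE x y : 0 < x <= xc -> 0 < y <= xc ->
  (level x < level y) = (y < x).
Proof.
move=> /andP[x0 xxc] /andP[y0 yxc]; apply/idP/idP => [|yx]; last exact: level_decr.
by apply: contraTT; rewrite -!leNgt le_eqVlt
  => /predU1P[->//|xy]; rewrite ltW // level_decr.
Qed.

Lemma level_incrE x y : xc <= x -> xc <= y -> (level x < level y) = (x < y).
Proof.
move=> xxc yxc; apply/idP/idP => [|xy]; last exact: level_incr.
by apply: contraTT; rewrite -!leNgt le_eqVlt
  => /predU1P[->//|yx]; rewrite ltW // level_incr.
Qed.

Lemma level_lower_bound x : 0 < x -> a ^+ 2 * b * x <= level x.
Proof.
move=> x0; have s0 := sqrt_shift_gt0 hb x0; have s2 := sqrt_shift_sqr hb x0.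
rewrite /level ler_pdivlMr // /turning.
move: (Num.sqrt _) s0 s2 => s s0 s2.
rewrite -subr_ge0.
have -> : (b * x + a) * (a * s + b) ^+ 2 - a ^+ 2 * b * x * x =
   b * x * (a ^+ 2 * b + 2 * a * b * s + b ^+ 2) + a * (a * s + b) ^+ 2
   + a ^+ 2 * b * x * (s ^+ 2 - x - b) by ring.
have -> : s ^+ 2 - x - b = 0 by rewrite s2; ring.
rewrite mulr0 addr0.
by rewrite addr_ge0 // mulr_ge0 ?sqr_ge0 ?addr_ge0 ?mulr_ge0 ?exprn_ge0 // ltW.
Qed.

(* The abscissa x_c when there is no such q. *)
Definition partner (p : R) := xget xc [set q | xc < q /\ level q = level p].

Lemma partner_spec p : 0 < p < xc -> xc < partner p /\ level (partner p) = level p.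
Proof.
move=> /andP[p0 pxc]; rewrite /partner; case: xgetP => [q _ //|].
have gp : level xc < level p by apply: level_decr.
(* Large enough for the lower bound a^2 b M to exceed the level of p. *)
pose M := xc + 1 + level p / (a ^+ 2 * b).
have K0 : 0 < a ^+ 2 * b by rewrite mulr_gt0 ?exprn_gt0.
have lp0 : 0 <= level p.
  by apply: le_trans (level_lower_bound p0); rewrite ltW // mulr_gt0.
have q0 : 0 <= level p / (a ^+ 2 * b) by rewrite divr_ge0 // ltW.
have xM : xc < M by rewrite /M; lra.
have M0 := lt_trans xc_gt0 xM.
have lM : level p < level M.
  apply: lt_le_trans (level_lower_bound M0).
  by rewrite mulrC -ltr_pdivrMr // /M; lra.
have [||q] := @IVT R level xc M (level p) (ltW xM).
- apply: continuous_in_subspaceT => x; rewrite inE /= in_itv /= => /andP[xcx _].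
  exact: is_derive_continuous (is_derive_level (lt_le_trans xc_gt0 xcx)).
- by rewrite ge_min le_max (ltW gp) (ltW lM) orbT.
rewrite in_itv /= => /andP[xq _] E /(_ q) /=; case; split => //.
rewrite lt_neqAle xq andbT; apply/eqP => xE.
by move: gp; rewrite -E -xE ltxx.
Qed.

Lemma partner_range p : 0 < p < xc -> oval_range a b (level p) p (partner p).
Proof.
move=> pr; have [xq lq] := partner_spec pr; case/andP: (pr) => p0 pxc.
have q0 := lt_trans xc_gt0 xq.
have pI : 0 < p <= xc by rewrite p0 ltW.
split.
- by rewrite p0 (lt_trans pxc).
- by split; [exact: level_mul|rewrite -lq; exact: level_mul].
- move=> x /andP[px xq']; have x0 := lt_trans p0 px.
  rewrite level_mul // ltr_pM2r //.
  have [xxc|xxc] := leP x xc; first by rewrite level_decrE // x0.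
  by rewrite -lq level_incrE // ltW.
- move=> x x0; rewrite level_mul // ler_pM2r // => lx.
  have [xxc|xxc] := leP x xc.
    rewrite (le_trans xxc (ltW xq)) andbT.
    by move: lx; rewrite !leNgt level_decrE ?x0.
  rewrite (ltW (lt_trans pxc xxc)) /=.
  by move: lx; rewrite -lq !leNgt level_incrE ?ltW.
split.
  have := turning_gapE p0; have := turning_gap_gt0 p0 => g0.
  have : (p - xc) * turning_gap p < 0 by rewrite nmulr_rlt0 // subr_lt0.
  lra.
have := turning_gapE q0; have := turning_gap_gt0 q0 => g0.
have : 0 < (partner p - xc) * turning_gap (partner p).
  by rewrite mulr_gt0 // subr_gt0.
lra.
Qed.

Lemma level_fixed : level xc = Vinv b a (xc, yc).
Proof.
rewrite /level /turning fixed_sqrt /Vinv /=.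
have -> : a * xc + b * yc + a * b = (a * yc + b) * yc.
  transitivity (a * (b + xc) + b * yc); first ring.
  by rewrite -yc_sqr; ring.
by field; rewrite !lt0r_neq0.
Qed.

Lemma level_continuous x : 0 < x -> {for x, continuous level}.
Proof. by move=> x0; exact: is_derive_continuous (is_derive_level x0). Qed.

(** The level increases on the right of xc, so comparing levels at q0 - e and q0 + e encloses the
    partner. When q0 - e < xc the lower comparison is replaced by partner > xc, which admits the
    limit case q0 = xc. *)
Lemma partner_cvg (F : set_system R) (FF : Filter F) (p0 q0 : R) :
  F --> p0 -> (\forall p \near F, 0 < p < xc) -> 0 < p0 ->
  xc <= q0 -> level q0 = level p0 -> partner p @[p --> F] --> q0.
Proof.
move=> Fp0 Fpc p00 xq0 lq0.
have lF : level p @[p --> F] --> level q0.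
  rewrite lq0; apply: cvg_comp Fp0 _; exact: level_continuous.
have q00 := lt_le_trans xc_gt0 xq0.
apply/cvgrPdist_lt => e e0.
have up : \forall p \near F, level p < level (q0 + e).
  by apply: (cvgr_lt (level q0)) => //; rewrite level_incrE ?ltrDl // ler_wpDr // ltW.
have lo : \forall p \near F, xc <= q0 - e -> level (q0 - e) < level p.
  have [xe|] := leP xc (q0 - e); last by move=> _; apply: filterE.
  have : \forall p \near F, level (q0 - e) < level p.
    by apply: (cvgr_gt (level q0)) => //; rewrite level_incrE // gtrDl oppr_lt0.
  by apply: filterS => p.
near=> p.
have pr : 0 < p < xc by near: p.
have [xq lq] := partner_spec pr.
have pup : level p < level (q0 + e) by near: p.
have plo : xc <= q0 - e -> level (q0 - e) < level p by near: p.
have : partner p < q0 + e.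
  have xe : xc <= q0 + e by rewrite (le_trans xq0) // lerDl ltW.
  by rewrite -level_incrE ?lq // ltW.
have : q0 - e < partner p.
  have [xe|xe] := leP xc (q0 - e); last exact: lt_trans xq.
  by rewrite -level_incrE ?lq ?plo // ltW.
by move=> h1 h2; rewrite ltr_norml; apply/andP; split; lra.
Unshelve. all: by end_near.
Qed.

End Level.

(** * Continuity of the rotation number *)

Section PrimitiveLimit.
Context {R : realType}.

Lemma primitive_close (f g : R -> R) (e : R) : continuous f -> continuous g ->
  (forall x, `|f x - g x| <= e) ->
  forall x, `|primitive f x - primitive g x| <= e * `|x|.
Proof.
move=> cf cg fg x.
have [F0 dF] := primitive_spec cf; have [G0 dG] := primitive_spec cg.
have dFG (y : R) := is_derive_sub (dF y) (dG y).
have FG0 : primitive f 0 - primitive g 0 = 0 by rewrite F0 G0 subrr.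
have [x0|/ltW x0] := leP 0 x.
  have [c _ E] := mean_value x0 (fun y _ => dFG y).
  by move: E; rewrite /= FG0 !subr0 => ->; rewrite normrM ler_wpM2r.
have [c _ E] := mean_value x0 (fun y _ => dFG y).
move: E; rewrite /= FG0 !sub0r => /eqP; rewrite eqr_oppLR => /eqP ->.
by rewrite mulrN opprK normrM ler_wpM2r.
Qed.

Lemma primitive_cst (c x : R) : primitive (fun=> c) x = c * x.
Proof.
have [F0 dF] := primitive_spec (@cst_continuous R R c).
have dx (y : R) := is_derive_sub (dF y)
  (is_derive_mul (is_derive_const c y) (is_derive_ident y)).
apply/eqP; rewrite -subr_eq0; apply/eqP.
transitivity (primitive (fun=> c) 0 - c * 0); last by rewrite F0 mulr0 subrr.
apply: (is_derive_zero (f := fun y => primitive (fun=> c) y - c * y)) => y.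
by apply: (is_derive_eq (dx y)); ring.
Qed.

Variables (T : Type) (F : set_system T).
Context {FF : Filter F}.

Lemma primitive_cvg (f : T -> R -> R) (g : R -> R) (u : T -> R) (v : R) :
  (\forall t \near F, continuous (f t)) -> continuous g ->
  (forall e, 0 < e -> \forall t \near F, forall x, `|f t x - g x| <= e) ->
  u t @[t --> F] --> v ->
  primitive (f t) (u t) @[t --> F] --> primitive g v.
Proof.
move=> cf cg fg uv.
have [_ dG] := primitive_spec cg.
have Gu : primitive g (u t) @[t --> F] --> primitive g v.
  by apply: (cvg_comp u (primitive g) uv); exact: is_derive_continuous (dG v).
apply/cvgrPdist_lt => e e0.
have K0 : 0 < `|v| + 1 by rewrite ltr_wpDl.
pose d := e / 2 / (`|v| + 1).
have e20 : 0 < e / 2 by rewrite divr_gt0.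
have d0 : 0 < d by rewrite divr_gt0.
near=> t.
have ft : continuous (f t) by near: t.
have fgt : forall x, `|f t x - g x| <= d by near: t; exact: fg.
have ut : `|v - u t| < 1 by near: t; move/cvgrPdist_lt : uv; apply.
have gut : `|primitive g v - primitive g (u t)| < e / 2.
  by near: t; move/cvgrPdist_lt : Gu; apply.
have W := primitive_close ft cg fgt (u t).
have un : `|u t| <= `|v| + 1.
  by rewrite -(subKr v (u t)) (le_trans (ler_normB _ _)) // lerD2l ltW.
have dE : d * `|u t| <= e / 2.
  by rewrite (le_trans (ler_wpM2l (ltW d0) un)) // /d divfK // lt0r_neq0.
rewrite (splitr e); apply: le_lt_trans (ltr_leD gut (le_trans W dE)).
rewrite [`|primitive (f t) _ - _|]distrC.
have -> : primitive g v - primitive (f t) (u t) =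
  (primitive g v - primitive g (u t)) + (primitive g (u t) - primitive (f t) (u t)).
  by ring.
exact: ler_normD.
Unshelve. all: by end_near.
Qed.

(** With u, v the square roots, 1/u - 1/v = (v^2 - u^2) / (u v (u + v)), and the denominator is at
    least 2 s^3. *)
Lemma inv_sqrt_close (x y s e : R) : 0 < s -> s ^+ 2 <= x -> s ^+ 2 <= y ->
  `|x - y| <= e * (2 * s ^+ 3) ->
  `|(Num.sqrt x)^-1 - (Num.sqrt y)^-1| <= e.
Proof.
move=> s0 sx sy xy.
have lower z : s ^+ 2 <= z -> s <= Num.sqrt z.
  by move=> sz; rewrite -[s]gtr0_norm // -sqrtr_sqr ler_sqrt //
    (le_trans _ sz) // sqr_ge0.
have x0 : 0 <= x := le_trans (sqr_ge0 s) sx.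
have y0 : 0 <= y := le_trans (sqr_ge0 s) sy.
have := lower _ sx; have := lower _ sy.
move: xy; rewrite -{1}(sqr_sqrtr x0) -{1}(sqr_sqrtr y0).
move: (Num.sqrt x) (Num.sqrt y) => u v xy sv su.
have u0 := lt_le_trans s0 su; have v0 := lt_le_trans s0 sv.
have -> : u^-1 - v^-1 = (v ^+ 2 - u ^+ 2) / (u * v * (u + v)).
  by field; rewrite !lt0r_neq0 // addr_gt0.
have P0 : 0 < u * v * (u + v) by rewrite !mulr_gt0 // addr_gt0.
rewrite normrM normfV (gtr0_norm P0) ler_pdivrMr // distrC.
have e0 : 0 <= e.
  have := le_trans (normr_ge0 _) xy; rewrite pmulr_lge0 //.
  by rewrite mulr_gt0 // exprn_gt0.
apply: le_trans xy _; apply: ler_wpM2l => //.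
have -> : 2 * s ^+ 3 = s * s * (s + s) by ring.
by rewrite ler_pM ?mulr_ge0 ?addr_ge0 ?ler_pM ?lerD // ltW.
Qed.

(** Under the square root stands a quadratic polynomial in cos x whose coefficients converge; as
    |cos x| <= 1, the convergence is uniform in x. The margin in 2 s^2 leaves s^2 as a lower bound
    near the limit. *)
Lemma clock_density_close (p q e0 e1 e2 : T -> R) (p' q' e0' e1' e2' s : R) :
  p t @[t --> F] --> p' -> q t @[t --> F] --> q' -> e0 t @[t --> F] --> e0' ->
  e1 t @[t --> F] --> e1' -> e2 t @[t --> F] --> e2' ->
  0 < s -> (forall x, 2 * s ^+ 2 <= quadratic e0' e1' e2' (abscissa p' q' x)) ->
  forall e, 0 < e -> \forall t \near F, forall x,
    `|clock_density (p t) (q t) (e0 t) (e1 t) (e2 t) x -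
      clock_density p' q' e0' e1' e2' x| <= e.
Proof.
move=> cp cq c0 c1 c2 s0 low e epos.
pose k0 p q e0 e1 e2 : R := quadratic e0 e1 e2 (midpoint p q).
pose k1 p q e1 e2 : R := - (halfwidth p q) * (e1 + 2 * e2 * midpoint p q).
pose k2 p q e2 : R := e2 * halfwidth p q ^+ 2.
have quadE p1 q1 f0 f1 f2 x : quadratic f0 f1 f2 (abscissa p1 q1 x) =
    k0 p1 q1 f0 f1 f2 + k1 p1 q1 f1 f2 * cos x + k2 p1 q1 f2 * cos x ^+ 2.
  by rewrite /quadratic /abscissa /k0 /k1 /k2 /quadratic; ring.
have cm : midpoint (p t) (q t) @[t --> F] --> midpoint p' q'.
  by apply: cvgMr_tmp; apply: cvgD.
have cd : halfwidth (p t) (q t) @[t --> F] --> halfwidth p' q'.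
  by apply: cvgMr_tmp; apply: cvgB.
have ck0 : k0 (p t) (q t) (e0 t) (e1 t) (e2 t) @[t --> F] --> k0 p' q' e0' e1' e2'.
  by apply: cvgD; [apply: cvgD => //; exact: cvgM|apply: cvgM => //; exact: cvgM].
have ck1 : k1 (p t) (q t) (e1 t) (e2 t) @[t --> F] --> k1 p' q' e1' e2'.
  apply: cvgM; first exact: cvgN.
  apply: cvgD => //; apply: cvgM => //; apply: cvgM => //; exact: cvg_cst.
have ck2 : k2 (p t) (q t) (e2 t) @[t --> F] --> k2 p' q' e2'.
  by apply: cvgM => //; exact: cvgM.
(* The first bound spends the margin s^2, the second meets [inv_sqrt_close]; r is shared among the
   three coefficients. *)
pose r := Num.min (s ^+ 2) (e * (2 * s ^+ 3)).
have r0 : 0 < r by rewrite lt_min exprn_gt0 //= !mulr_gt0 // exprn_gt0.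
have r30 : 0 < r / 3 by rewrite divr_gt0.
near=> t => x.
have d0 : `|k0 p' q' e0' e1' e2' - k0 (p t) (q t) (e0 t) (e1 t) (e2 t)| < r / 3.
  by near: t; move/cvgrPdist_lt : ck0; apply.
have d1 : `|k1 p' q' e1' e2' - k1 (p t) (q t) (e1 t) (e2 t)| < r / 3.
  by near: t; move/cvgrPdist_lt : ck1; apply.
have d2 : `|k2 p' q' e2' - k2 (p t) (q t) (e2 t)| < r / 3.
  by near: t; move/cvgrPdist_lt : ck2; apply.
have D : `|quadratic (e0 t) (e1 t) (e2 t) (abscissa (p t) (q t) x) -
    quadratic e0' e1' e2' (abscissa p' q' x)| <= r.
  rewrite distrC !quadE.
  set A0 := k0 p' _ _ _ _; set A1 := k1 p' _ _ _; set A2 := k2 p' _ _.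
  set B0 := k0 _ _ _ _ _; set B1 := k1 _ _ _ _; set B2 := k2 _ _ _.
  have -> : A0 + A1 * cos x + A2 * cos x ^+ 2 - (B0 + B1 * cos x + B2 * cos x ^+ 2)
    = (A0 - B0) + (A1 - B1) * cos x + (A2 - B2) * cos x ^+ 2 by ring.
  have cx := cos_max x.
  have cx2 : `|cos x ^+ 2| <= 1 by rewrite normrX expr_le1.
  have h1 : `|(A1 - B1) * cos x| <= r / 3.
    by rewrite normrM (le_trans (ler_wpM2l (normr_ge0 _) cx)) // mulr1 ltW.
  have h2 : `|(A2 - B2) * cos x ^+ 2| <= r / 3.
    by rewrite normrM (le_trans (ler_wpM2l (normr_ge0 _) cx2)) // mulr1 ltW.
  apply: le_trans (ler_normD _ _) _.
  have := ler_normD (A0 - B0) ((A1 - B1) * cos x).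
  by have := ltW d0; rewrite -/A0 -/B0; lra.
have rs : r <= s ^+ 2 by rewrite ge_min lexx.
have re : r <= e * (2 * s ^+ 3) by rewrite ge_min lexx orbT.
have := low x => lx.
apply: (inv_sqrt_close s0).
- by move: D; rewrite ler_norml => /andP[]; lra.
- by have := sqr_ge0 s; lra.
- exact: le_trans D re.
Unshelve. all: by end_near.
Qed.

End PrimitiveLimit.

Section RotationLimit.
Context {R : realType}.
Variables a b xc yc : R.
Hypotheses (ha : 0 < a) (hb : 0 < b) (xc_gt0 : 0 < xc) (yc_gt0 : 0 < yc)
  (xc_sqr : xc ^+ 2 = a + yc) (yc_sqr : yc ^+ 2 = b + xc).
Local Notation level := (level a b).
Local Notation partner := (partner a b xc).

Definition gap_factor (p : R) :=
  4 * a ^+ 2 * b ^+ 2 * (b * p + a) * (a * Num.sqrt (p + b) + b).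

Lemma gap_factor_gt0 p : 0 < p -> 0 < gap_factor p.
Proof.
move=> p0; have sp := sqrt_shift_gt0 hb p0.
by rewrite /gap_factor !mulr_gt0 // ?exprn_gt0 // addr_gt0 // mulr_gt0.
Qed.

(** [rotation_cosine] is 1 - 2 (X1 - p) / (q - p), which is 0 / 0 at p = q = x_c. By [quot_endpoint]
    the ratio equals quot(p) / [gap_factor p], which extends there. *)
Definition limit_cosine (h p q : R) := 1 - 2 * quot a b h p q p / gap_factor p.

Lemma rotation_cosineE h p q : oval_range a b h p q ->
  rotation_cosine a b p q = limit_cosine h p q.
Proof.
move=> [[p0 pq] [Hp Hq] _ _ _].
have pqn : p != q by rewrite lt_eqF.
have := quot_endpoint hb p0 (lt_trans p0 pq) pqn Hp Hq.
rewrite /= -/(gap_factor p) => E.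
have K1 := lt0r_neq0 (gap_factor_gt0 p0).
have p1 := lt0r_neq0 p0.
have qp : q - p != 0 by rewrite subr_eq0 eq_sym.
have -> : limit_cosine h p q =
    1 - 2 * (p * (q - p) * quot a b h p q p) / (gap_factor p * (p * (q - p))).
  by rewrite /limit_cosine; field; rewrite K1 p1 qp.
by rewrite E /rotation_cosine /first_image; field; rewrite K1 p1 qp.
Qed.

Definition partner_rotation (p : R) := rotation_number a b (level p) p (partner p).

Lemma cvg_sqr (F : set_system R) (FF : Filter F) (f : R -> R) (l : R) :
  f p @[p --> F] --> l -> f p ^+ 2 @[p --> F] --> l ^+ 2.
Proof. by move=> fl; rewrite expr2; apply: cvgM. Qed.

(** The filter stands for the neighbourhoods of an interior point and for the left neighbourhoods of
    xc. In the second case p0 = q0 = xc bounds no oval, so the properties of the limit density are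
    hypotheses. *)
Lemma partner_rotation_cvg (F : set_system R) (FF : Filter F) (p0 q0 s : R) :
  let h0 := level p0 in
  F --> p0 -> (\forall p \near F, 0 < p < xc) -> 0 < p0 ->
  xc <= q0 -> level q0 = h0 -> 0 < s ->
  (forall x, 2 * s ^+ 2 <= quot a b h0 p0 q0 (abscissa p0 q0 x)) ->
  continuous (oval_density a b h0 p0 q0) -> oval_period a b h0 p0 q0 != 0 ->
  -1 < limit_cosine h0 p0 q0 < 1 ->
  partner_rotation p @[p --> F] -->
  oval_time a b h0 p0 q0 (acos (limit_cosine h0 p0 q0)) / oval_period a b h0 p0 q0.
Proof.
move=> h0 Fp0 Fpc p00 xq0 lq0 s0 low cw T0 c0.
have cq : partner p @[p --> F] --> q0.
  exact: (partner_cvg ha hb xc_gt0 yc_gt0 xc_sqr yc_sqr FF Fp0 Fpc p00 xq0 lq0).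
have ch : level p @[p --> F] --> h0.
  have cl : {for p0, continuous level}.
    exact: (level_continuous hb yc_gt0 xc_sqr yc_sqr).
  exact: cvg_comp Fp0 cl.
have cp : p @[p --> F] --> p0 by [].
pose d3 p := discr3 a b (level p); pose d2 p := discr2 a b (level p).
have c3 : d3 p @[p --> F] --> discr3 a b h0.
  apply: cvgB; last exact: cvg_cst.
  apply: cvgM; first exact: cvg_cst.
  by apply: cvgB; first exact: cvg_cst.
have c2 : d2 p @[p --> F] --> discr2 a b h0.
  apply: cvgB; last exact: cvg_cst.
  apply: cvgD; last exact: cvg_cst.
  apply: cvg_sqr.
  by apply: cvgB; first exact: cvg_cst.
have cpq : p + partner p @[p --> F] --> p0 + q0 by exact: cvgD.
have ce1 : quot1 a b (level p) p (partner p) @[p --> F] --> quot1 a b h0 p0 q0.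
  apply: cvgN; apply: cvgD => //; apply: cvgM => //; exact: cvg_cst.
have ce0 : quot0 a b (level p) p (partner p) @[p --> F] --> quot0 a b h0 p0 q0.
  apply: cvgN; apply: cvgD.
    by apply: cvgD => //; exact: cvgM.
  apply: cvgM; first exact: cvg_cst.
  by apply: cvgD; [apply: cvgD; [exact: cvg_sqr|exact: cvgM]|exact: cvg_sqr].
have ce2 : (fun p : R => quot2 a b) p @[p --> F] --> quot2 a b by exact: cvg_cst.
have cquot : quot a b (level p) p (partner p) p @[p --> F] --> quot a b h0 p0 q0 p0.
  apply: cvgD; first by apply: cvgD => //; exact: cvgM.
  by apply: cvgM => //; exact: cvg_sqr.
have cK : gap_factor p @[p --> F] --> gap_factor p0.
  apply: cvgM.
    apply: cvgM; first exact: cvg_cst.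
    by apply: cvgD; [apply: cvgM => //; exact: cvg_cst|exact: cvg_cst].
  apply: cvgD; last exact: cvg_cst.
  apply: cvgM; first exact: cvg_cst.
  apply: (cvg_comp (fun p => p + b) Num.sqrt); last exact: sqrt_continuous.
  by apply: cvgD => //; exact: cvg_cst.
have cc : limit_cosine (level p) p (partner p) @[p --> F] --> limit_cosine h0 p0 q0.
  apply: cvgB; first exact: cvg_cst.
  apply: cvgM; first by apply: cvgM => //; exact: cvg_cst.
  by apply: cvgV => //; rewrite lt0r_neq0 // gap_factor_gt0.
have crc : rotation_cosine a b p (partner p) @[p --> F] --> limit_cosine h0 p0 q0.
  apply: cvg_trans cc; apply: near_eq_cvg.
  apply: filterS Fpc => p pr; symmetry; apply: rotation_cosineE.
  exact: (partner_range ha hb xc_gt0 yc_gt0 xc_sqr yc_sqr).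
have cac : acos (rotation_cosine a b p (partner p)) @[p --> F] -->
    acos (limit_cosine h0 p0 q0).
  by apply: cvg_comp crc _; exact: continuous_acos.
have close := clock_density_close (FF := FF) cp cq ce0 ce1 ce2 s0 low.
have Fcw : \forall p \near F, continuous (oval_density a b (level p) p (partner p)).
  apply: filterS Fpc => p pr.
  have rg := partner_range ha hb xc_gt0 yc_gt0 xc_sqr yc_sqr pr.
  apply: clock_density_continuous; first by case: rg => [[]].
  exact: quot_gt0 rg.
have num : rotation_time a b (level p) p (partner p) @[p --> F] -->
    oval_time a b h0 p0 q0 (acos (limit_cosine h0 p0 q0)).
  exact: (@primitive_cvg R R F FF (fun p => oval_density a b (level p) p (partner p))
    _ (fun p => acos (rotation_cosine a b p (partner p))) _ Fcw cw close cac).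
have ctpi : (fun _ : R => 2 * pi) p @[p --> F] --> (2 * pi : R) by exact: cvg_cst.
have den : oval_period a b (level p) p (partner p) @[p --> F] -->
    oval_period a b h0 p0 q0.
  exact: (@primitive_cvg R R F FF (fun p => oval_density a b (level p) p (partner p))
    _ (fun=> 2 * pi) _ Fcw cw close ctpi).
by apply: cvgM num _; exact: cvgV.
Qed.

Let rg p (pr : 0 < p < xc) := partner_range ha hb xc_gt0 yc_gt0 xc_sqr yc_sqr pr.

Lemma partner_rotation_continuous p : 0 < p < xc ->
  {for p, continuous partner_rotation}.
Proof.
move=> pr; have pqh := rg pr.
have [[p0 pq] _ _ _ _] := pqh.
have [xq lq] := partner_spec ha hb xc_gt0 yc_gt0 xc_sqr yc_sqr pr.
have cE : continuous (quot a b (level p) p (partner p)).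
  by move=> x; exact: is_derive_continuous (is_derive_quadratic _ _ _ _).
(* The uniform lower bound on the density's radicand comes from compactness of [p, q]. *)
have [x0 x0I xmin] := EVT_min (ltW pq) (continuous_subspaceT cE).
have M0 : 0 < quot a b (level p) p (partner p) x0.
  by apply: (quot_gt0 ha hb pqh); move: x0I; rewrite in_itv.
pose s := Num.sqrt (quot a b (level p) p (partner p) x0 / 2).
have s0 : 0 < s by rewrite sqrtr_gt0 divr_gt0.
have c0 := rotation_cosine_bounds ha hb pqh.
have E_gt0 := quot_gt0 ha hb pqh.
have RE : partner_rotation p = oval_time a b (level p) p (partner p)
    (acos (limit_cosine (level p) p (partner p))) /
    oval_period a b (level p) p (partner p).
  by rewrite -(rotation_cosineE pqh).
suff : partner_rotation x @[x --> p] --> partner_rotation p by [].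
rewrite RE.
have /= H := @partner_rotation_cvg (nbhs p) _ p (partner p) s.
apply: H => //.
- have : \forall x \near p, x \in `]0, xc[ by apply: near_in_itvoo; rewrite in_itv.
  by apply: filterS => x; rewrite in_itv.
- exact: ltW.
- move=> x; rewrite sqr_sqrtr ?divr_ge0 ?(ltW M0) // mulrC divfK //.
  by apply: xmin; rewrite in_itv /= abscissa_bounds.
- exact: clock_density_continuous.
- exact/lt0r_neq0/clock_period_gt0.
- by rewrite -(rotation_cosineE pqh).
Qed.


(** The derivative of x^2 - a - sqrt (x + b) at xc. *)
Definition fixed_slope := 2 * xc - (2 * yc)^-1.

(** The limit of [quot_endpoint]: there a + s - p^2 is about (xc - p) [fixed_slope], and q - p about
    2 (xc - p). As p = q is excluded in that lemma, the value is computed after eliminating a and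
    b. *)
Lemma quot_fixed : quot a b (level xc) xc xc xc =
  gap_factor xc / (2 * xc) * fixed_slope.
Proof.
have x1 := lt0r_neq0 xc_gt0; have y1 := lt0r_neq0 yc_gt0.
have hE : level xc = (b * xc + a) * (a * yc + b) ^+ 2 / xc.
  by rewrite /level /turning (fixed_sqrt yc_gt0 yc_sqr).
rewrite /gap_factor (fixed_sqrt yc_gt0 yc_sqr) /fixed_slope hE.
have bE : b = yc ^+ 2 - xc by rewrite yc_sqr addrK.
have aE : a = xc ^+ 2 - yc by rewrite xc_sqr addrK.
rewrite /quot /quadratic /quot0 /quot1 /quot2 /discr3 /discr2.
rewrite bE aE.
by field; rewrite x1 y1.
Qed.

Lemma limit_cosine_fixed :
  limit_cosine (level xc) xc xc = 2^-1 * (-2 + (xc * yc)^-1).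
Proof.
have x1 := lt0r_neq0 xc_gt0; have y1 := lt0r_neq0 yc_gt0.
have K1 := lt0r_neq0 (gap_factor_gt0 xc_gt0).
by rewrite /limit_cosine quot_fixed /fixed_slope; field; rewrite x1 y1 K1.
Qed.

Lemma partner_rotation_cvg_fixed :
  partner_rotation p @[p --> xc^'-] -->
  (2 * pi)^-1 * acos (2^-1 * (-2 + (xc * yc)^-1)).
Proof.
have x1 := lt0r_neq0 xc_gt0; have y1 := lt0r_neq0 yc_gt0.
have xy := fixed_prod_gt1 ha hb xc_gt0 yc_gt0 xc_sqr yc_sqr.
have xy0 := mulr_gt0 xc_gt0 yc_gt0.
pose E := quot a b (level xc) xc xc xc.
have E0 : 0 < E.
  rewrite /E quot_fixed mulr_gt0 //.
    by rewrite divr_gt0 ?gap_factor_gt0 // mulr_gt0.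
  rewrite /fixed_slope subr_gt0 -div1r ltr_pdivrMr ?mulr_gt0 //.
  by lra.
have EX x : quot a b (level xc) xc xc (abscissa xc xc x) = E.
  suff -> : abscissa xc xc x = xc by [].
  by rewrite /abscissa /midpoint /halfwidth; field.
pose s := Num.sqrt (E / 2).
have s0 : 0 < s by rewrite sqrtr_gt0 divr_gt0.
have dens : oval_density a b (level xc) xc xc = fun=> (Num.sqrt E)^-1.
  by apply/funext => x; rewrite /oval_density /clock_density -/(quot _ _ _ _ _ _) EX.
have cw : continuous (oval_density a b (level xc) xc xc).
  by rewrite dens; exact: cst_continuous.
have timeE x : oval_time a b (level xc) xc xc x = (Num.sqrt E)^-1 * x.
  by rewrite /oval_time dens primitive_cst.
have S0 : 0 < (Num.sqrt E)^-1 by rewrite invr_gt0 sqrtr_gt0.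
have pi0 := pi_gt0 R.
have T0 : oval_period a b (level xc) xc xc != 0.
  by rewrite /oval_period timeE lt0r_neq0 // !mulr_gt0.
have v0 : 0 < (xc * yc)^-1 < 1 by rewrite invr_gt0 xy0 invf_lt1.
have c0 : -1 < limit_cosine (level xc) xc xc < 1.
  by rewrite limit_cosine_fixed; apply/andP; split; lra.
have -> : (2 * pi)^-1 * acos (2^-1 * (-2 + (xc * yc)^-1)) =
    oval_time a b (level xc) xc xc (acos (limit_cosine (level xc) xc xc))
    / oval_period a b (level xc) xc xc.
  rewrite /oval_period !timeE limit_cosine_fixed.
  have S1 : Num.sqrt E != 0 by rewrite lt0r_neq0 // sqrtr_gt0.
  have := lt0r_neq0 pi0; move: (pi : R) => P P1.
  by field; rewrite S1 P1.
have /= H := @partner_rotation_cvg (xc^'-) _ xc xc s.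
apply: H => //.
- exact: cvg_at_left_filter.
- near=> p; apply/andP; split; near: p; first exact: nbhs_left_gt.
  exact: nbhs_left_lt.
- by move=> x; rewrite EX sqr_sqrtr ?divr_ge0 ?(ltW E0) // mulrC divfK.
Unshelve. all: by end_near.
Qed.

End RotationLimit.

(** * The limit 2/5 *)

Section LargeLevel.
Context {R : realType}.
Variables a b h p q : R.
Hypotheses (ha : 0 < a) (hb : 0 < b) (pqh : oval_range a b h p q).
Local Notation fx := (flow_abscissa a b h p q).
Local Notation fr := (flow_radical a b h p q).
Local Notation fy := (flow_ordinate a b h p q).
Local Notation T := (oval_period a b h p q).
Local Notation t1 := (rotation_time a b h p q).
Local Notation turning := (turning a b).
Local Notation theta := (rotation_number a b h p q).

Let p_gt0 : 0 < p. Proof. by case: pqh => [[]]. Qed.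
Let pq : p < q. Proof. by case: pqh => [[]]. Qed.
Let E_gt0 := quot_gt0 ha hb pqh.
Let T_gt0 : 0 < T := clock_period_gt0 pq E_gt0.
Let fx_gt0 t : 0 < fx t := oval_range_gt0 pqh (flow_abscissa_bounds pqh t).

Lemma turning_nondecr x y : 0 < x -> x <= y -> turning x <= turning y.
Proof.
move=> x0 xy; have y0 := lt_le_trans x0 xy.
have sx := sqrt_shift_gt0 hb x0.
have sxy : Num.sqrt (x + b) <= Num.sqrt (y + b).
  by rewrite ler_sqrt ?lerD2r // ltW // addr_gt0.
rewrite /turning; apply: ler_pM.
- by rewrite ltW // addr_gt0 // mulr_gt0.
- exact: sqr_ge0.
- by rewrite lerD2r ler_pM2l.
by rewrite lerXn2r ?nnegrE ?addr_ge0 ?mulr_ge0 ?sqrtr_ge0 ?(ltW ha) ?(ltW hb) //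
  lerD2r ler_pM2l.
Qed.

(** The factors of [discriminantE] are at most h x: for the larger one, 4 a b (b x + a) s <= turning
    x because (a s - b)^2 >= 0. *)
Lemma flow_radical_le t : fr t <= h * fx t.
Proof.
have xpq := flow_abscissa_bounds pqh t.
have x0 := fx_gt0 t; have sx := sqrt_shift_gt0 hb x0.
have hx := oval_range_turning pqh xpq.
have D := flow_radical_sqr ha hb pqh t.
have N2 : 4 * a * b * (b * fx t + a) * Num.sqrt (fx t + b) <= turning (fx t).
  rewrite -subr_ge0 /turning.
  have -> : (b * fx t + a) * (a * Num.sqrt (fx t + b) + b) ^+ 2 -
    4 * a * b * (b * fx t + a) * Num.sqrt (fx t + b) =
    (b * fx t + a) * (a * Num.sqrt (fx t + b) - b) ^+ 2 by ring.
  by rewrite mulr_ge0 ?sqr_ge0 // ltW // addr_gt0 // mulr_gt0.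
have N0 : 0 <= turning (fx t).
  by rewrite mulr_ge0 ?sqr_ge0 // ltW // addr_gt0 // mulr_gt0.
have hx0 : 0 <= h * fx t := le_trans N0 hx.
have : fr t ^+ 2 <= (h * fx t) ^+ 2.
  rewrite D discriminantE // [leRHS]expr2; apply: ler_pM; try lra.
  have : 0 < 4 * a * b * (b * fx t + a) * Num.sqrt (fx t + b).
    by rewrite !mulr_gt0 // addr_gt0 // mulr_gt0.
  by lra.
move=> le2; apply: le_trans (ler_norm _) _.
by rewrite -sqrtr_sqr -[leRHS]ger0_norm // -[leRHS]sqrtr_sqr ler_sqrt // sqr_ge0.
Qed.

(** x' <= h x along the half period from p to q. As q exceeds x_c, this makes h T unbounded when p
    tends to 0. *)
Lemma oval_period_lower_bound : q <= p * expR (h * (T / 2)).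
Proof.
pose g t := fx t * expR (- h * t).
have dg (t : R) : is_derive t 1 g ((fr t - h * fx t) * expR (- h * t)).
  have dx := is_derive_flow_abscissa ha hb pqh t.
  have dl := is_derive_mul (is_derive_const (- h) t) (is_derive_ident t).
  have de := is_derive_comp (g := fun s => - h * s) (is_derive_expR _) dl.
  by apply: (is_derive_eq (is_derive_mul dx de)); ring.
have T20 : 0 <= T / 2 by rewrite divr_ge0 // ltW.
have [c _ E] := mean_value T20 (fun t _ => dg t).
have g0 : g 0 = p.
  have [x0 _ _] := flow_start ha hb pqh.
  by rewrite /g x0 mulr0 expR0 mulr1.
have gT : g (T / 2) = q * expR (- (h * (T / 2))).
  have xT : fx (T / 2) = q := flow_x_half pq E_gt0.
  by rewrite /g xT mulNr.
have le_gT : g (T / 2) <= p.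
  move: E; rewrite g0 subr0 => E.
  rewrite -subr_le0 E; apply: mulr_le0_ge0 => //.
  by apply: mulr_le0_ge0; rewrite ?expR_ge0 // subr_le0 flow_radical_le.
move: le_gT; rewrite gT expRN ler_pdivrMr ?expR_gt0 //.
Qed.

Lemma flow_radical_ge0 t : 0 <= t <= T / 2 -> 0 <= fr t.
Proof.
move=> /andP[]; rewrite le_eqVlt => /predU1P[<- _|t0].
  by have [_ -> _] := flow_start ha hb pqh.
rewrite le_eqVlt => /predU1P[->|tT].
  have xT : fx (T / 2) = q := flow_x_half pq E_gt0.
  suff /eqP : fr (T / 2) ^+ 2 = 0 by rewrite sqrf_eq0 => /eqP ->.
  rewrite (flow_radical_sqr ha hb pqh) xT discriminant_root //.
    exact: lt_trans pq.
  by case: pqh => _ [].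
by apply: ltW; apply: (flow_r_gt0 pq E_gt0); rewrite t0.
Qed.

Lemma flow_abscissa_mono u v : 0 <= u -> u <= v -> v <= T / 2 -> fx u <= fx v.
Proof.
move=> u0 uv vT.
have [c /andP[uc cv] E] := mean_value uv (fun t _ => is_derive_flow_abscissa ha hb pqh t).
rewrite -subr_ge0 E mulr_ge0 ?subr_ge0 // flow_radical_ge0 //.
by rewrite (le_trans u0 uc) (le_trans cv).
Qed.

(** For abscissas in [c1, c2], turning <= h c1 / 2, so both factors of [discriminantE] are at least
    h c1 / 2, and so is the speed x'. *)
Lemma travel_time_le c1 c2 u v : 0 < c1 -> turning c2 <= h * c1 / 2 ->
  0 <= u -> u <= v -> v <= T / 2 -> c1 <= fx u -> fx v <= c2 ->
  (v - u) * (h * c1 / 2) <= c2.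
Proof.
move=> c10 hc u0 uv vT c1u vc2.
have [c /andP[uc cv] E] := mean_value uv (fun t _ => is_derive_flow_abscissa ha hb pqh t).
have xu : fx u <= fx c by rewrite flow_abscissa_mono // (le_trans cv).
have xv : fx c <= fx v by rewrite flow_abscissa_mono // (le_trans u0).
have x0 := fx_gt0 c; have sx := sqrt_shift_gt0 hb x0.
have tx : turning (fx c) <= turning c2 by rewrite turning_nondecr // (le_trans xv).
have h_gt0 : 0 < h.
  have := oval_range_turning pqh (flow_abscissa_bounds pqh c).
  have N0 : 0 < turning (fx c).
    by rewrite mulr_gt0 // ?exprn_gt0 // addr_gt0 // mulr_gt0.
  by move=> /(lt_le_trans N0); rewrite pmulr_lgt0.
have k0 : 0 < h * c1 / 2 by rewrite divr_gt0 // mulr_gt0.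
have hx : h * c1 <= h * fx c by rewrite ler_pM2l // (le_trans c1u).
have low : (h * c1 / 2) ^+ 2 <= fr c ^+ 2.
  rewrite (flow_radical_sqr ha hb pqh) discriminantE // expr2.
  have : 0 < 4 * a * b * (b * fx c + a) * Num.sqrt (fx c + b).
    by rewrite !mulr_gt0 // addr_gt0 // mulr_gt0.
  by move=> ?; apply: ler_pM; lra.
have r0 : 0 <= fr c by rewrite flow_radical_ge0 // (le_trans u0 uc) (le_trans cv).
have rk : h * c1 / 2 <= fr c.
  by move: low; rewrite ler_pXn2r ?nnegrE ?(ltW k0).
have : (v - u) * (h * c1 / 2) <= fx v - fx u.
  by rewrite E mulrC ler_wpM2r // subr_ge0.
by have := fx_gt0 u; lra.
Qed.

(* P2 and P3 are reached at times 2 t1 and 3 t1. By the symmetry t -> T - t their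
   abscissas are also those at times T - 2 t1 and 3 t1 - T of the increasing half
   of the orbit, and these times are close by [travel_time_le]. *)
Lemma rotation_number_near_two_fifths c1 c2 eps :
  let P2 := Fmap b a (first_image a b p, second_image a b p) in
  let P3 := Fmap b a P2 in
  0 < c1 -> turning c2 <= h * c1 / 2 -> 2 * curveA a b c2 < h * c1 / 2 ->
  c1 <= P2.1 <= c2 -> P2.2 <= 1 -> c1 <= P3.1 <= c2 ->
  eps <= 1 / 4 -> 2 * c2 < eps * (h * T) * c1 ->
  `|theta - 2 / 5| <= eps.
Proof.
move=> P2 P3 c10 hc hA P2x P2y P3x eps4 heps.
have [x1 y1] := flow_rotation_time ha hb pqh.
have F2 : P2 = (fx (t1 + t1), fy (t1 + t1)).
  by rewrite -(Fmap_flow ha hb pqh) x1 y1.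
have F3 : P3 = (fx (t1 + t1 + t1), fy (t1 + t1 + t1)).
  by rewrite -(Fmap_flow ha hb pqh) -F2.
rewrite F2 /= in P2x P2y; rewrite F3 /= in P3x.
case/andP: P2x => P2l P2u; case/andP: P3x => P3l P3u.
set X2 := fx (t1 + t1) in P2l P2u.
(* P2 is low on the curve: with y <= 1, the terms 2Ay and turning x together stay below h c1 <= h x.
   Hence P2 lies on the half where x decreases, and 2 t1 > T / 2. *)
have r_lt0 : fr (t1 + t1) < 0.
  rewrite flow_radicalE // -/X2 /field_x curveB_turning //; last exact: fx_gt0.
  have X20 : 0 < X2 := fx_gt0 _.
  have tx : turning X2 <= turning c2 by rewrite turning_nondecr.
  have h0 : 0 < h.
    have c20 := lt_le_trans c10 (le_trans P2l P2u).
    have A0 := curveA_gt0 ha hb c20.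
    have : 0 < h * c1 by lra.
    by rewrite pmulr_lgt0.
  have hx : h * c1 <= h * X2 by rewrite ler_pM2l.
  have A2 : curveA a b X2 * fy (t1 + t1) <= curveA a b c2.
    have A0 := curveA_gt0 ha hb X20.
    apply: (@le_trans _ _ (curveA a b X2 * 1)); first by rewrite ler_pM2l.
    by rewrite mulr1 /curveA ler_pM2l ?mulr_gt0 // lerD2r ler_pM2l.
  have : 0 < 2 * a * b * (b * X2 + a) * Num.sqrt (X2 + b).
    by rewrite !mulr_gt0 ?sqrt_shift_gt0 // addr_gt0 // mulr_gt0.
  by lra.
have /andP[th0 th2] := rotation_number_bounds ha hb pqh.
have tE : t1 = theta * T by rewrite /rotation_number divfK // lt0r_neq0.
have t10 : 0 <= t1 by rewrite tE mulr_ge0 // ltW.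
have t12 : t1 + t1 <= T.
  by have : theta * T <= 2^-1 * T; [rewrite ler_wpM2r // ltW|rewrite -tE; lra].
have t1half : T / 2 < t1 + t1.
  rewrite ltNge; apply/negP => t1T.
  have := @flow_radical_ge0 (t1 + t1); rewrite t1T (addr_ge0 t10 t10).
  by move=> /(_ isT); rewrite leNgt r_lt0.
have per s : fx (s - T) = fx s.
  have /(congr1 fst) /= <- := flow_periodic ha hb pqh (s - T).
  by rewrite subrK.
have even s : fx (T - s) = fx s.
  have <- : fx (- (T - s)) = fx (T - s) := flow_x_even pq E_gt0 (T - s).
  by rewrite opprB per.
pose u := T - (t1 + t1).
have xu : fx u = X2 by exact: even.
have u0 : 0 <= u by rewrite subr_ge0.
have uT : u <= T / 2 by rewrite /u; lra.
have key v : 0 <= v -> v <= T / 2 -> fx v = fx (t1 + t1 + t1) -> `|u - v| < eps * T.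
  move=> v0 vT xv.
  have k0 : 0 < h * c1.
    have c20 := lt_le_trans c10 (le_trans P2l P2u).
    have := curveA_gt0 ha hb c20; lra.
  rewrite -(ltr_pM2r (x := h * c1 / 2)) ?divr_gt0 //.
  apply: (@le_lt_trans _ _ c2); last by lra.
  have [uv|/ltW vu] := leP u v.
    by rewrite distrC ger0_norm ?subr_ge0 // travel_time_le // ?xu ?xv.
  by rewrite ger0_norm ?subr_ge0 // travel_time_le // ?xu ?xv.
(* If 3 t1 <= T, the two close times differ by t1, so t1 < T / 4, against 2 t1 > T / 2; this is
   where eps <= 1 / 4 serves. Otherwise they differ by |2 T - 5 t1|. *)
have [t3|t3] := leP (t1 + t1 + t1) T.
  have := key (T - (t1 + t1 + t1)); rewrite even subr_ge0 t3.
  have -> : T - (t1 + t1 + t1) <= T / 2 by lra.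
  move=> /(_ isT isT erefl); rewrite /u.
  have -> : T - (t1 + t1) - (T - (t1 + t1 + t1)) = t1 by ring.
  have : eps * T <= 1 / 4 * T by rewrite ler_wpM2r // ltW.
  by rewrite ger0_norm //; lra.
have := key (t1 + t1 + t1 - T); rewrite per subr_ge0 (ltW t3).
have -> : t1 + t1 + t1 - T <= T / 2 by lra.
move=> /(_ isT isT erefl); rewrite /u.
have -> : T - (t1 + t1) - (t1 + t1 + t1 - T) = - (5 * (theta - 2 / 5) * T).
  by rewrite tE; field.
rewrite normrN normrM (gtr0_norm T_gt0) ltr_pM2r // normrM ger0_norm //.
by have := normr_ge0 (theta - 2 / 5); lra.
Qed.

End LargeLevel.

(** * The orbit of the leftmost point as p tends to 0 *)

Section SmallAbscissa.
Context {R : realType}.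
Variables a b xc yc : R.
Hypotheses (ha : 0 < a) (hb : 0 < b) (xc_gt0 : 0 < xc) (yc_gt0 : 0 < yc)
  (xc_sqr : xc ^+ 2 = a + yc) (yc_sqr : yc ^+ 2 = b + xc).

(** Counting the leftmost point as the first of its orbit, the third is its image by F^2. The powers
    of p that make the first image escape have been cancelled, so these expressions have limits at p
    = 0. *)
Definition third_abscissa (p : R) := let s := Num.sqrt (p + b) in
  (a * p * s + b * p + a + s) / (s * (a + s)).
Definition third_ordinate (p : R) := let s := Num.sqrt (p + b) in
  (b + third_abscissa p) * (p * s) / (b * p + a + s).
Definition fourth_abscissa (p : R) := (a + third_ordinate p) / third_abscissa p.

Lemma third_imageE p : 0 < p ->
  Fmap b a (first_image a b p, second_image a b p) =
  (third_abscissa p, third_ordinate p).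
Proof.
move=> p0; have := sqrt_shift_gt0 hb p0.
rewrite /third_ordinate /third_abscissa /second_image /first_image /Fmap /=.
move: (Num.sqrt _) => s s0.
have p1 := lt0r_neq0 p0; have s1 := lt0r_neq0 s0.
have as1 : a + s != 0 by rewrite lt0r_neq0 // addr_gt0.
have bas1 : b * p + a + s != 0 by rewrite lt0r_neq0 // !addr_gt0 // mulr_gt0.
have bas2 : b * p + (a + s) != 0 by rewrite addrA.
by congr (_, _); field; rewrite ?p1 ?s1 ?as1 ?bas1 ?bas2.
Qed.

Let beta := (Num.sqrt b)^-1.
Let sb_gt0 : 0 < Num.sqrt b. Proof. by rewrite sqrtr_gt0. Qed.
Let beta_gt0 : 0 < beta. Proof. by rewrite invr_gt0. Qed.
Let cvg_id0 : p @[p --> 0^'+] --> (0 : R).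
Proof. exact: cvg_at_right_filter. Qed.

Let cvg_sqrt_shift : Num.sqrt (p + b) @[p --> 0^'+] --> Num.sqrt b.
Proof.
have -> : Num.sqrt b = Num.sqrt (0 + b) by rewrite add0r.
apply: (cvg_comp (fun p => p + b) Num.sqrt); last exact: sqrt_continuous.
by apply: cvgD => //; exact: cvg_cst.
Qed.

Lemma third_abscissa_cvg : third_abscissa p @[p --> 0^'+] --> beta.
Proof.
have ab0 := addr_gt0 ha sb_gt0.
have -> : beta = (a * 0 * Num.sqrt b + b * 0 + a + Num.sqrt b) /
    (Num.sqrt b * (a + Num.sqrt b)).
  by rewrite /beta; field; rewrite !lt0r_neq0.
apply: cvgM.
  apply: cvgD => //; apply: cvgD; last exact: cvg_cst.
  apply: cvgD; last by apply: cvgM => //; exact: cvg_cst.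
  by apply: cvgM => //; apply: cvgM => //; exact: cvg_cst.
apply: cvgV; first by rewrite lt0r_neq0 // mulr_gt0.
by apply: cvgM => //; apply: cvgD => //; exact: cvg_cst.
Qed.

Lemma third_ordinate_cvg : third_ordinate p @[p --> 0^'+] --> (0 : R).
Proof.
have ab0 := addr_gt0 ha sb_gt0.
have E : (b + beta) * (0 * Num.sqrt b) / (b * 0 + a + Num.sqrt b) = 0.
  by rewrite !mul0r mulr0 mul0r.
suff : third_ordinate p @[p --> 0^'+] -->
    (b + beta) * (0 * Num.sqrt b) / (b * 0 + a + Num.sqrt b) by rewrite E.
apply: cvgM.
  apply: cvgM; last exact: cvgM.
  by apply: cvgD; [exact: cvg_cst|exact: third_abscissa_cvg].
apply: cvgV; first by rewrite mulr0 add0r lt0r_neq0.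
apply: cvgD => //; apply: cvgD; last exact: cvg_cst.
by apply: cvgM => //; exact: cvg_cst.
Qed.

Lemma fourth_abscissa_cvg : fourth_abscissa p @[p --> 0^'+] --> a / beta.
Proof.
have E : (a + 0) / beta = a / beta by rewrite addr0.
suff : fourth_abscissa p @[p --> 0^'+] --> (a + 0) / beta by rewrite E.
apply: cvgM.
  by apply: cvgD; [exact: cvg_cst|exact: third_ordinate_cvg].
by apply: cvgV; [rewrite lt0r_neq0|exact: third_abscissa_cvg].
Qed.

(** turning p >= a b^2, so the level is at least a b^2 / p. *)
Lemma level_unbounded (K : R) : \forall p \near 0^'+, K <= level a b p.
Proof.
have ab2 : 0 < a * b ^+ 2 by rewrite mulr_gt0 ?exprn_gt0.
have K0 : 0 < `|K| + 1 by rewrite ltr_wpDl.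
near=> p.
have p0 : 0 < p by near: p; exact: nbhs_right_gt.
have pK : p < a * b ^+ 2 / (`|K| + 1).
  by near: p; apply: nbhs_right_lt; rewrite divr_gt0.
apply: (@le_trans _ _ (`|K| + 1)).
  by rewrite (le_trans (ler_norm _)) // lerDl.
rewrite /level ler_pdivlMr //.
move: pK; rewrite ltr_pdivlMr // mulrC => /ltW/le_trans; apply.
have s0 := sqrt_shift_gt0 hb p0.
apply: ler_pM; rewrite ?ltW //; try exact: exprn_gt0.
- by rewrite ltrDr mulr_gt0.
by rewrite ltrXn2r ?nnegrE ?addr_ge0 ?mulr_ge0 ?ltW // ltrDr mulr_gt0.
Unshelve. all: by end_near.
Qed.

Lemma partner_rotation_cvg_zero :
  partner_rotation a b xc p @[p --> 0^'+] --> (2 / 5 : R).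
Proof.
apply/cvgrPdist_le => e e0.
pose eps := Num.min e (1 / 4).
have b0 : 0 < beta by exact: beta_gt0.
have eps0 : 0 < eps by rewrite lt_min e0 divr_gt0.
have g0 : 0 < a / beta by rewrite divr_gt0.
(* A factor 2 on either side of the limit abscissas beta and a / beta. *)
pose c1 := Num.min (beta / 2) (a / beta / 2).
pose c2 := Num.max (beta * 2) (a / beta * 2).
have c10 : 0 < c1 by rewrite lt_min !divr_gt0.
(* A level above [K] meets both largeness conditions at c2. With p < xc exp(- M), the chain xc < q
   <= p exp(h T / 2) forces h T / 2 > M, which is the condition on the period. *)
pose K := (turning a b c2 + 2 * curveA a b c2 + 1) * 2 / c1.
pose M := c2 / (eps * c1).
have c20 : 0 < c2 by rewrite lt_max mulr_gt0.
near=> p.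
have p0 : 0 < p by near: p; exact: nbhs_right_gt.
have pxc : p < xc by near: p; exact: nbhs_right_lt.
have pr : 0 < p < xc by rewrite p0.
have pM : p < xc * expR (- M).
  by near: p; apply: nbhs_right_lt; rewrite mulr_gt0 // expR_gt0.
have hK : K <= level a b p by near: p; exact: level_unbounded.
have x2l : beta / 2 < third_abscissa p.
  by near: p; apply: (cvgr_gt beta third_abscissa_cvg); lra.
have x2u : third_abscissa p < beta * 2.
  by near: p; apply: (cvgr_lt beta third_abscissa_cvg); lra.
have y2 : third_ordinate p < 1.
  by near: p; exact: (cvgr_lt 0 third_ordinate_cvg).
have x3l : a / beta / 2 < fourth_abscissa p.
  by near: p; apply: (cvgr_gt (a / beta) fourth_abscissa_cvg); lra.
have x3u : fourth_abscissa p < a / beta * 2.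
  by near: p; apply: (cvgr_lt (a / beta) fourth_abscissa_cvg); lra.
have pqh := partner_range ha hb xc_gt0 yc_gt0 xc_sqr yc_sqr pr.
have [xq _] := partner_spec ha hb xc_gt0 yc_gt0 xc_sqr yc_sqr pr.
rewrite distrC; apply: (@le_trans _ _ eps); last by rewrite ge_min lexx.
have hc1 : turning a b c2 + 2 * curveA a b c2 + 1 <= level a b p * c1 / 2.
  by move: hK; rewrite /K ler_pdivrMr //; lra.
have A0 := curveA_gt0 ha hb c20.
have N0 : 0 <= turning a b c2.
  by rewrite mulr_ge0 ?sqr_ge0 // ltW // addr_gt0 // mulr_gt0.
apply: (rotation_number_near_two_fifths ha hb pqh c10 (c2 := c2)).
- by lra.
- by lra.
- rewrite third_imageE //=; apply/andP; split.
    by rewrite ge_min (ltW x2l).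
  by rewrite le_max (ltW x2u).
- by rewrite third_imageE //= ltW.
- rewrite third_imageE //= -/(fourth_abscissa p); apply/andP; split.
    by rewrite ge_min (ltW x3l) orbT.
  by rewrite le_max (ltW x3u) orbT.
- by rewrite ge_min lexx orbT.
set T := oval_period _ _ _ _ _.
have hT : M < level a b p * (T / 2).
  rewrite ltNge; apply/negP => hM.
  have := oval_period_lower_bound ha hb pqh; rewrite -/T => qp.
  have : xc < p * expR M.
    apply: lt_le_trans xq (le_trans qp _).
    by rewrite ler_pM2l // ler_expR.
  rewrite ltNge => /negP; apply; apply: ltW.
  by move: pM; rewrite expRN ltr_pdivlMr // expR_gt0.
by move: hT; rewrite /M ltr_pdivrMr ?mulr_gt0 //; lra.
Unshelve. all: by end_near.
Qed.

End SmallAbscissa.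

(** * The intermediate value argument *)

Unset Implicit Arguments.

Theorem theorem1 (R : realType) (a b xc yc : R)
    (ha : 0 < a) (hb : 0 < b)
    (hc : quadrant (xc, yc))
    (hfix : Fmap b a (xc, yc) = (xc, yc)) :
  sigma a b xc = (2 * pi)^-1 * acos (2^-1 * (-2 + (xc * yc)^-1)) /\
  forall theta : R,
    Num.min (sigma a b xc) (2 / 5) < theta < Num.max (sigma a b xc) (2 / 5) ->
    exists h : R, Vinv b a (xc, yc) < h /\
      has_rotation_number (oval b a h) (Fmap b a) theta.
Proof.
have [/= xc_gt0 yc_gt0] := hc.
have x1 := lt0r_neq0 xc_gt0; have y1 := lt0r_neq0 yc_gt0.
have xc_sqr : xc ^+ 2 = a + yc.
  have /(congr1 fst) /= E := hfix.
  by rewrite expr2 -{1}E divfK.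
have yc_sqr : yc ^+ 2 = b + xc.
  have /(congr1 snd) /= E := hfix.
  apply: (mulfI x1); rewrite expr2 -{1}E.
  have -> : a = xc ^+ 2 - yc by rewrite xc_sqr addrK.
  by field; rewrite x1 y1.
have sigmaE : sigma a b xc = (2 * pi)^-1 * acos (2^-1 * (-2 + (xc * yc)^-1)).
  rewrite /sigma; congr (_ * acos (_ * _)).
  have -> : b + xc = yc ^+ 2 by [].
  have -> : a = xc ^+ 2 - yc by rewrite xc_sqr addrK.
  have -> : b = yc ^+ 2 - xc by rewrite yc_sqr addrK.
  by field; rewrite x1 y1.
split=> // theta; rewrite sigmaE.
set l := (2 * pi)^-1 * _ => hth.
pose f := partner_rotation a b xc.
have f_xc : f p @[p --> xc^'-] --> l.
  exact: partner_rotation_cvg_fixed ha hb xc_gt0 yc_gt0 xc_sqr yc_sqr.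
have f_0 : f p @[p --> 0^'+] --> (2 / 5 : R).
  exact: (@partner_rotation_cvg_zero R a b xc yc).
have x20 : 0 < xc / 2 by rewrite divr_gt0.
have x2x : xc / 2 < xc by lra.
(* The point xc / 2 only serves to order the two witnesses p1 < p2. *)
have near0 : \forall p \near 0^'+, 0 < p < xc / 2.
  by near=> p; apply/andP; split; near: p; [exact: nbhs_right_gt|exact: nbhs_right_lt].
have nearxc : \forall p \near xc^'-, xc / 2 < p < xc.
  by near=> p; apply/andP; split; near: p; [exact: nbhs_left_gt|exact: nbhs_left_lt].
have [p1 [p2 [p1I p2I v]]] : exists p1 p2, [/\ 0 < p1 < xc / 2, xc / 2 < p2 < xc &
    Num.min (f p1) (f p2) <= theta <= Num.max (f p1) (f p2)].
  have [l5|l5] := leP l (2 / 5).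
    move: hth; rewrite (min_idPl l5) (max_idPr l5) => /andP[lt t5].
    have [p1 [p1I f1]] := filter_ex (filterI near0 (cvgr_gt _ f_0 _ t5)).
    have [p2 [p2I f2]] := filter_ex (filterI nearxc (cvgr_lt _ f_xc _ lt)).
    by exists p1, p2; split=> //; rewrite ge_min le_max (ltW f1) (ltW f2) orbT.
  move: hth; rewrite (min_idPr (ltW l5)) (max_idPl (ltW l5)) => /andP[t5 lt].
  have [p1 [p1I f1]] := filter_ex (filterI near0 (cvgr_lt _ f_0 _ t5)).
  have [p2 [p2I f2]] := filter_ex (filterI nearxc (cvgr_gt _ f_xc _ lt)).
  by exists p1, p2; split=> //; rewrite ge_min le_max (ltW f1) (ltW f2) orbT.
case/andP: p1I => p10 p1x; case/andP: p2I => p2x p2xc.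
have p12 : p1 <= p2 by rewrite ltW // (lt_trans p1x).
have [|p] := @IVT R f p1 p2 theta p12 _ v.
  apply: continuous_in_subspaceT => p; rewrite inE /= in_itv /= => /andP[pl pu].
  apply: (partner_rotation_continuous ha hb xc_gt0 yc_gt0 xc_sqr yc_sqr).
  by rewrite (lt_le_trans p10) //= (le_lt_trans pu).
rewrite in_itv /= => /andP[pl pu] fp.
have pr : 0 < p < xc by rewrite (lt_le_trans p10) //= (le_lt_trans pu).
exists (level a b p); split.
  rewrite -(level_fixed a xc_gt0 yc_gt0 yc_sqr).
  have /andP[p0 pxc] := pr.
  exact: (level_decr ha hb xc_gt0 yc_gt0 xc_sqr yc_sqr).
rewrite -fp; apply: oval_has_rotation_number => //.
exact: (partner_range ha hb xc_gt0 yc_gt0 xc_sqr yc_sqr).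
Unshelve. all: by end_near.
Qed.
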